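(* Let $J\subseteq\Pi$ and let $U$ be a reflection overgroup of $W_J$ in $W$. Assume that $\operatorname{corank}_U(W_J)=k\in\mathbb{N}$. (a) If $U$ is a parabolic subgroup of $W$, then $U$ is a maximal corank $k$ reflection overgroup of $W_J$. (b) Assume that $\Pi_U$ is linearly independent. Then the set of all corank $k$ reflection overgroups of $W_J$ which contain $U$ has a maximum element (under inclusion). In particular, $U$ is a reflection subgroup of a unique maximal corank $k$ reflection overgroup of $W_J$. (c) Assume that $\Pi_U$ is linearly independent and that $\Phi_U=\Phi\cap\operatorname{span}(\Phi_U)$. Then $U$ is a maximal corank $k$ reflection overgroup of $W_J$. Let $I$ be the set of all maximal corank $k+1$ reflection overgroups of $W_J$ which contain $U$. Then $\Phi\setminus\Phi_U$ is the disjoint union $\bigsqcup_{W'\in I}(\Phi_{W'}\setminus\Phi_U)$.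
   Context: For a subset $X$ of a real vector space, $\operatorname{span}(X)$ is its linear span and $\operatorname{cone}(X)$ the set of finite linear combinations of elements of $X$ with non-negative coefficients (including $0$). $(V,B)$ is a real vector space with a symmetric bilinear form; for $B(\alpha,\alpha)\neq 0$, $s_\alpha(v)=v-\frac{2B(v,\alpha)}{B(\alpha,\alpha)}\alpha$. $(\Phi,\Pi)$ is a based root system in $(V,B)$ with associated Coxeter system $(W,S)$: $\Pi\subseteq V$; $\operatorname{cone}(\Pi)\cap\operatorname{cone}(-\Pi)=\{0\}$; for all $\alpha\in\Pi$, $\alpha\notin\operatorname{cone}(\Pi\setminus\{\alpha\})$ and $B(\alpha,\alpha)=1$; $S=\{s_\alpha\mid\alpha\in\Pi\}$, $W=\langle S\rangle$; $\Phi=\{w\alpha\mid w\in W,\alpha\in\Pi\}$ satisfies $\Phi=\Phi^+\cup\Phi^-$ where $\Phi^{\pm}=\Phi\cap\operatorname{cone}(\pm\Pi)$. The rank $|S|$ may be infinite and $\Pi$ need not be linearly independent. $T=\{s_\alpha\mid\alpha\in\Phi\}$ is the set of reflections; $\alpha\mapsto s_\alpha$ is a bijection $\Phi^+\to T$. For $w\in W$, $N(w)=\{t\in T\mid \ell(tw)<\ell(w)\}$ where $\ell$ is the standard length function. For $J\subseteq\Pi$, $W_J=\langle s_\alpha\mid\alpha\in J\rangle$ is a standard parabolic subgroup; parabolic subgroups are the $W$-conjugates of standard parabolic subgroups. A reflection subgroup $U$ of $W$ is a subgroup with $U=\langle U\cap T\rangle$. Put $\chi(U)=\{t\in T\mid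 N(t)\cap U=\{t\}\}$; $(U,\chi(U))$ is a Coxeter system with set of reflections $U\cap T$. Put $\Phi_U=\{\alpha\in\Phi\mid s_\alpha\in U\}$ and $\Pi_U=\{\alpha\in\Phi^+\mid s_\alpha\in\chi(U)\}$; $(\Phi_U,\Pi_U)$ is a based root system. For reflection subgroups $U'\subseteq U$, $\operatorname{corank}_U(U')$ is the minimum cardinality of a subset $T'\subseteq U\cap T$ with $U=\langle (U'\cap T)\cup T'\rangle$. A reflection overgroup of $W_J$ is a reflection subgroup $U\supseteq W_J$ of $W$; then $J\subseteq\Pi_U$ and $\operatorname{corank}_U(W_J)=|\Pi_U\setminus J|$; if this equals $k$, $U$ is called a corank $k$ reflection overgroup of $W_J$. A maximal corank $k$ reflection overgroup of $W_J$ is an inclusion-maximal element of the set of corank $k$ reflection overgroups of $W_J$. *)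

(* Defs.v *)
From mathcomp Require Import all_boot all_order all_algebra.
From mathcomp Require Import all_classical all_reals.

Set Implicit Arguments.
Unset Strict Implicit.
Unset Printing Implicit Defensive.

Import Order.TTheory GRing.Theory Num.Theory.
Local Open Scope classical_set_scope.
Local Open Scope ring_scope.
Local Open Scope card_scope.

Definition lin_span (R : realType) (V : lmodType R) (X : set V) : set V :=
  [set v | exists (s : seq V) (c : V -> R),
     (forall x, x \in s -> X x) /\ v = \sum_(x <- s) c x *: x].

Definition conic_span (R : realType) (V : lmodType R) (X : set V) : set V :=
  [set v | exists (s : seq V) (c : V -> R),
     (forall x, x \in s -> X x /\ 0 <= c x) /\ v = \sum_(x <- s) c x *: x].

Definition lin_indep (R : realType) (V : lmodType R) (X : set V) : Prop :=
  forall (s : seq V) (c : V -> R), uniq s -> (forall x, x \in s -> X x) ->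
    \sum_(x <- s) c x *: x = 0 -> forall x, x \in s -> c x = 0.

(* Groups of transformations of a type [A] are represented as sets of maps
   [A -> A] closed under composition and two-sided inverses. *)
Definition transf_group (A : Type) (G : set (A -> A)) : Prop :=
  [/\ G id,
      forall f g, G f -> G g -> G (f \o g)
    & forall f, G f -> exists2 g, G g & cancel f g /\ cancel g f].

(* Meaningful when [X] consists of bijections; otherwise no group contains [X]
   and [gen_group X] is the full set of maps. *)
Definition gen_group (A : Type) (X : set (A -> A)) : set (A -> A) :=
  smallest (@transf_group A) X.

Definition sym_refl (R : realType) (V : lmodType R) (B : {symmetric V}) (a : V) :
    V -> V :=
  fun v => v - (2 * B v a / B a a) *: a.

Definition refl_group (R : realType) (V : lmodType R) (B : {symmetric V})
    (J : set V) : set (V -> V) :=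
  gen_group [set sym_refl B a | a in J].

Record basedRootSystem (R : realType) (V : lmodType R) (B : {symmetric V}) :=
  BasedRootSystem {
    root_set : set V;
    simple_roots : set V;
    cone_simple_pointed :
      conic_span simple_roots `&` conic_span [set - a | a in simple_roots] = [set 0];
    simple_notin_cone : forall a, simple_roots a ->
      ~ conic_span (simple_roots `\ a) a;
    simple_norm1 : forall a, simple_roots a -> B a a = 1;
    rootsE :
      root_set = [set w a | w in refl_group B simple_roots & a in simple_roots];
    roots_pos_neg :
      root_set = (root_set `&` conic_span simple_roots)
              `|` (root_set `&` conic_span [set - a | a in simple_roots])
  }.

Definition pos_roots (R : realType) (V : lmodType R) (B : {symmetric V})
    (rs : basedRootSystem B) : set V :=
  root_set rs `&` conic_span (simple_roots rs).

Definition coxeter_group (R : realType) (V : lmodType R) (B : {symmetric V})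
    (rs : basedRootSystem B) : set (V -> V) :=
  refl_group B (simple_roots rs).

Definition simple_refls (R : realType) (V : lmodType R) (B : {symmetric V})
    (rs : basedRootSystem B) : set (V -> V) :=
  [set sym_refl B a | a in simple_roots rs].

Definition reflections (R : realType) (V : lmodType R) (B : {symmetric V})
    (rs : basedRootSystem B) : set (V -> V) :=
  [set sym_refl B a | a in root_set rs].

Definition simple_word (R : realType) (V : lmodType R) (B : {symmetric V})
    (rs : basedRootSystem B) (w : V -> V) (n : nat) : Prop :=
  exists f : 'I_n -> (V -> V),
    (forall i, simple_refls rs (f i)) /\ w = \big[comp/id]_(i < n) f i.

(* The default value 0 is only used outside of [coxeter_group rs]. *)
Definition cox_length (R : realType) (V : lmodType R) (B : {symmetric V})
    (rs : basedRootSystem B) (w : V -> V) : nat :=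
  xget 0%N [set n | simple_word rs w n /\
                    forall m, simple_word rs w m -> (n <= m)%N].

Definition inversions (R : realType) (V : lmodType R) (B : {symmetric V})
    (rs : basedRootSystem B) (w : V -> V) : set (V -> V) :=
  [set t | reflections rs t /\ (cox_length rs (t \o w) < cox_length rs w)%N].

Definition parabolic (R : realType) (V : lmodType R) (B : {symmetric V})
    (rs : basedRootSystem B) (U : set (V -> V)) : Prop :=
  exists (w w' : V -> V) (K : set V),
    [/\ coxeter_group rs w, cancel w w' /\ cancel w' w,
        K `<=` simple_roots rs
      & U = [set w \o u \o w' | u in refl_group B K]].

Definition reflection_subgroup (R : realType) (V : lmodType R)
    (B : {symmetric V}) (rs : basedRootSystem B) (U : set (V -> V)) : Prop :=
  [/\ transf_group U, U `<=` coxeter_group rs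
    & U = gen_group (U `&` reflections rs)].

Definition canonical_gens (R : realType) (V : lmodType R) (B : {symmetric V})
    (rs : basedRootSystem B) (U : set (V -> V)) : set (V -> V) :=
  [set t | reflections rs t /\ inversions rs t `&` U = [set t]].

Definition roots_of (R : realType) (V : lmodType R) (B : {symmetric V})
    (rs : basedRootSystem B) (U : set (V -> V)) : set V :=
  [set a | root_set rs a /\ U (sym_refl B a)].

Definition simple_roots_of (R : realType) (V : lmodType R) (B : {symmetric V})
    (rs : basedRootSystem B) (U : set (V -> V)) : set V :=
  [set a | pos_roots rs a /\ canonical_gens rs U (sym_refl B a)].

Definition corank_gens (R : realType) (V : lmodType R) (B : {symmetric V})
    (rs : basedRootSystem B) (U U' T' : set (V -> V)) : Prop :=
  T' `<=` U `&` reflections rs /\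
  U = gen_group ((U' `&` reflections rs) `|` T').

(* The minimum cardinality is possibly infinite; [has_corank rs U U' k] says
   that it is the natural number [k]. *)
Definition has_corank (R : realType) (V : lmodType R) (B : {symmetric V})
    (rs : basedRootSystem B) (U U' : set (V -> V)) (k : nat) : Prop :=
  (exists2 T', corank_gens rs U U' T' & T' #= `I_k) /\
  (forall T', corank_gens rs U U' T' -> `I_k #<= T').

Definition reflection_overgroup (R : realType) (V : lmodType R)
    (B : {symmetric V}) (rs : basedRootSystem B) (J : set V)
    (U : set (V -> V)) : Prop :=
  reflection_subgroup rs U /\ refl_group B J `<=` U.

Definition corank_overgroup (R : realType) (V : lmodType R)
    (B : {symmetric V}) (rs : basedRootSystem B) (J : set V) (k : nat)
    (U : set (V -> V)) : Prop :=
  reflection_overgroup rs J U /\ has_corank rs U (refl_group B J) k.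

Definition max_corank_overgroup (R : realType) (V : lmodType R)
    (B : {symmetric V}) (rs : basedRootSystem B) (J : set V) (k : nat)
    (U : set (V -> V)) : Prop :=
  corank_overgroup rs J k U /\
  forall U', corank_overgroup rs J k U' -> U `<=` U' -> U' = U.

(* Main.v *)
Require Import Defs.
From mathcomp Require Import all_boot all_order all_algebra.
From mathcomp Require Import all_classical all_reals.
From mathcomp Require Import ring.

Set Implicit Arguments.
Unset Strict Implicit.
Unset Printing Implicit Defensive.

Import Order.TTheory GRing.Theory Num.Theory.
Local Open Scope classical_set_scope.
Local Open Scope ring_scope.

(** The corank is a dimension, provided that dimensions are measured in a space
    where the simple roots are linearly independent.

    Let [M] be a reflection subgroup containing [W_J]. Its roots [Phi_M], with the
    positive roots [Pi_M] that are simple in [Phi_M], form a based root system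
    again ([subsystem_generated], [sub_brs]), and [J] lies in [Pi_M]. The vectors of
    [Pi_M] may be linearly dependent, but the root system lifts: given a linear map
    [pi : E -> V] and a vector [e a] above each simple root [a], there is a map
    [rho] from the roots to [E] with [pi (rho b) = b], [rho a = e a] for [a] simple
    and [rho (s_a b) = rho b - 2 B(b, a) rho a]. The reason is that the reflections
    [x |-> x - 2 B(pi x, a) e a] of [E] still satisfy the exchange condition, so
    that [w (e a)] is a conic combination of the [e c] or the opposite of one
    ([lift_sign]), and such a vector is determined by its image in [V] as soon as
    this image is simple ([lift_cone_simple]). With [e a = (a, 1_a)] in [V * R^V],
    the lifted simple roots are linearly independent.

    If [U] is generated by reflections along the elements of [X], then any map that
    transforms reflections as [rho] does sends [Phi_U] into the span of the image
    of [X] ([refl_group_span]). So, if [U] is generated by [W_J] and [n]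
    reflections, then the lift of [Phi_U] has dimension at most [n] modulo the lift
    of [J] ([generated_span]). Conversely [Pi_U] generates [U], so that a corank
    equal to [k] gives at least [k] elements of [Pi_U] outside [J].

    (b) Let [Pi_U] be independent and let [y_1, ..., y_k] be in [Pi_U] outside [J].
    They are independent modulo [J] in [V], hence also after lifting. Let [M] be
    generated by all the corank [k] overgroups [U'] of [W_J] that contain [U], and
    lift [Phi_M] along [Pi_M]. Each lifted [Phi_U'] has dimension at most [k] modulo
    [J] and contains the lifts of the [y_i], so it lies in the span of [J] and these
    lifts; so does the lift of [Phi_M]. As the lift of [Pi_M] is free, [Pi_M] has at
    most [k] elements outside [J]: the corank of [M] is [k]
    ([overgroup_join_corank]). Only the existence of [k] roots of [U] independent
    modulo [J] has been used.

    (c) If moreover [Phi_U] contains all the roots in its span, the same dimension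
    count in [V] shows that [U] is maximal. For a root [a] outside [Phi_U], the group
    generated by [U] and [s_a] has corank [k + 1] and [k + 1] roots independent
    modulo [J] ([adjoin_root]), so by the proof of (b) exactly one maximal corank
    [k + 1] overgroup contains it.

    (a) Let [U = w W_K w^-1], with [w K] made of positive roots. Then [J] is
    contained in [w K], the lift of [w K] along [Pi] is free, and a root is in
    [Phi_U] if and only if its lift is in the span of the lift of [w K]
    ([parabolic_root]); the dimension count of (c) then applies to the lift. *)

(** * Linear and conic spans *)

Section Spans.
Context (R : realType) (V : lmodType R).
Implicit Types (X Y : set V) (u v x y : V) (l : seq (R * V)).

(** The spans are defined by coefficients that depend on the vector alone; lists of
    pairs of a coefficient and a vector are easier to concatenate, and grouping
    equal vectors goes back to the definition. *)
Lemma sum_regroup l :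
  \sum_(p <- l) p.1 *: p.2
  = \sum_(x <- undup (map snd l)) (\sum_(p <- l | p.2 == x) p.1) *: x.
Proof.
under [RHS]eq_bigr do rewrite scaler_suml.
rewrite (exchange_big_dep xpredT) //=.
rewrite !big_seq; apply: eq_bigr => p pl.
rewrite (eq_bigl (fun x => x == p.2)); last by move=> x; rewrite eq_sym.
rewrite -big_filter filter_pred1_uniq ?undup_uniq ?big_seq1//.
by rewrite mem_undup map_f.
Qed.

Lemma conic_spanP X v :
  conic_span X v <->
  exists2 l, (forall p, p \in l -> X p.2 /\ 0 <= p.1) & v = \sum_(p <- l) p.1 *: p.2.
Proof.
split=> [[s [c [sX ->]]]|[l lX ->]].
  exists [seq (c x, x) | x <- s]; last by rewrite big_map.
  by move=> p /mapP[x /sX xs ->].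
exists (undup (map snd l)), (fun x => \sum_(p <- l | p.2 == x) p.1).
split; last exact: sum_regroup.
move=> x; rewrite mem_undup => /mapP[p pl ->]; split; first by case: (lX _ pl).
by rewrite big_seq_cond sumr_ge0 // => q /andP[/lX[]].
Qed.

Lemma lin_spanP X v :
  lin_span X v <->
  exists2 l, (forall p, p \in l -> X p.2) & v = \sum_(p <- l) p.1 *: p.2.
Proof.
split=> [[s [c [sX ->]]]|[l lX ->]].
  exists [seq (c x, x) | x <- s]; last by rewrite big_map.
  by move=> p /mapP[x /sX xs ->].
exists (undup (map snd l)), (fun x => \sum_(p <- l | p.2 == x) p.1).
split; last exact: sum_regroup.
by move=> x; rewrite mem_undup => /mapP[p pl ->]; apply: lX.
Qed.

Lemma conic_span_ind X (P : V -> Prop) :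
  P 0 ->
  (forall c x v, 0 <= c -> X x -> conic_span X v -> P v -> P (c *: x + v)) ->
  forall v, conic_span X v -> P v.
Proof.
move=> P0 PD v /conic_spanP[l + ->]; elim: l => [|p l IH] lX.
  by rewrite big_nil.
have lX' q : q \in l -> X q.2 /\ 0 <= q.1.
  by move=> ql; apply: lX; rewrite inE ql orbT.
have [Xp p0] := lX p (mem_head _ _).
by rewrite big_cons; apply: PD => //; [apply/conic_spanP; exists l|exact: IH].
Qed.

Lemma lin_span_ind X (P : V -> Prop) :
  P 0 -> (forall c x v, X x -> lin_span X v -> P v -> P (c *: x + v)) ->
  forall v, lin_span X v -> P v.
Proof.
move=> P0 PD v /lin_spanP[l + ->]; elim: l => [|p l IH] lX.
  by rewrite big_nil.
have lX' q : q \in l -> X q.2.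
  by move=> ql; apply: lX; rewrite inE ql orbT.
have Xp := lX p (mem_head _ _).
by rewrite big_cons; apply: PD => //; [apply/lin_spanP; exists l|exact: IH].
Qed.

Lemma conic_span0 X : conic_span X 0.
Proof. by apply/conic_spanP; exists [::]; rewrite ?big_nil. Qed.

Lemma conic_spanD X u v : conic_span X u -> conic_span X v -> conic_span X (u + v).
Proof.
move=> /conic_spanP[l1 h1 ->] /conic_spanP[l2 h2 ->].
apply/conic_spanP; exists (l1 ++ l2); last by rewrite big_cat.
by move=> p; rewrite mem_cat => /orP[/h1|/h2].
Qed.

Lemma conic_spanZ X c v : 0 <= c -> conic_span X v -> conic_span X (c *: v).
Proof.
move=> c0 /conic_spanP[l h ->].
apply/conic_spanP; exists [seq (c * p.1, p.2) | p <- l].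
  by move=> _ /mapP[p /h[Xp p0] ->] /=; rewrite mulr_ge0.
by rewrite big_map scaler_sumr; apply: eq_bigr => p _; rewrite /= scalerA.
Qed.

Lemma conic_span_mem X x : X x -> conic_span X x.
Proof.
move=> Xx; apply/conic_spanP; exists [:: (1, x)].
  by move=> p; rewrite inE => /eqP ->.
by rewrite big_seq1 scale1r.
Qed.

Lemma lin_span0 X : lin_span X 0.
Proof. by apply/lin_spanP; exists [::]; rewrite ?big_nil. Qed.

Lemma lin_spanD X u v : lin_span X u -> lin_span X v -> lin_span X (u + v).
Proof.
move=> /lin_spanP[l1 h1 ->] /lin_spanP[l2 h2 ->].
apply/lin_spanP; exists (l1 ++ l2); last by rewrite big_cat.
by move=> p; rewrite mem_cat => /orP[/h1|/h2].
Qed.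

Lemma lin_spanZ X c v : lin_span X v -> lin_span X (c *: v).
Proof.
move=> /lin_spanP[l h ->].
apply/lin_spanP; exists [seq (c * p.1, p.2) | p <- l].
  by move=> _ /mapP[p /h Xp ->].
by rewrite big_map scaler_sumr; apply: eq_bigr => p _; rewrite /= scalerA.
Qed.

Lemma lin_spanN X v : lin_span X v -> lin_span X (- v).
Proof. by rewrite -scaleN1r; apply: lin_spanZ. Qed.

Lemma lin_spanB X u v : lin_span X u -> lin_span X v -> lin_span X (u - v).
Proof. by move=> hu hv; apply/lin_spanD/lin_spanN. Qed.

Lemma lin_span_mem X x : X x -> lin_span X x.
Proof.
move=> Xx; apply/lin_spanP; exists [:: (1, x)].
  by move=> p; rewrite inE => /eqP ->.
by rewrite big_seq1 scale1r.
Qed.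

Lemma lin_span_sum X (I : Type) (r : seq I) (P : pred I) (F : I -> V) :
  (forall i, P i -> lin_span X (F i)) -> lin_span X (\sum_(i <- r | P i) F i).
Proof.
move=> FX; elim/big_rec: _ => [|i v /FX ? ?]; first exact: lin_span0.
exact: lin_spanD.
Qed.

Lemma lin_span_sub X Y : X `<=` lin_span Y -> lin_span X `<=` lin_span Y.
Proof.
move=> XY v; elim/lin_span_ind=> [|c x w Xx _ IH]; first exact: lin_span0.
by apply: lin_spanD IH; apply/lin_spanZ/XY.
Qed.

Lemma conic_span_sub X Y : X `<=` conic_span Y -> conic_span X `<=` conic_span Y.
Proof.
move=> XY v; elim/conic_span_ind=> [|c x w c0 Xx _ IH]; first exact: conic_span0.
by apply: conic_spanD IH; apply: conic_spanZ => //; apply: XY.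
Qed.

Lemma conic_span_lin X : conic_span X `<=` lin_span X.
Proof.
move=> v; elim/conic_span_ind=> [|c x w c0 Xx _ IH]; first exact: lin_span0.
by apply: lin_spanD IH; apply/lin_spanZ/lin_span_mem.
Qed.

Lemma conic_spanN X v : conic_span [set - x | x in X] v <-> conic_span X (- v).
Proof.
split.
  elim/conic_span_ind=> [|c _ w c0 [x Xx <-] _ IH].
    by rewrite oppr0; exact: conic_span0.
  rewrite opprD scalerN opprK; apply: conic_spanD IH.
  by apply: conic_spanZ => //; apply: conic_span_mem.
rewrite -{2}(opprK v); move: (- v) => {}v.
elim/conic_span_ind=> [|c x w c0 Xx _ IH].
  by rewrite oppr0; exact: conic_span0.
rewrite opprD -scalerN; apply: conic_spanD IH.
by apply: conic_spanZ => //; apply: conic_span_mem; exists x.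
Qed.

(** A conic combination can have the coefficient of one generator singled out. *)
Lemma conic_span_split X a v : conic_span X v ->
  exists2 p, 0 <= p & exists2 w, conic_span (X `\ a) w & v = p *: a + w.
Proof.
elim/conic_span_ind=> [|c x w c0 Xx _ [p p0 [w' w'X ->]]].
  by exists 0 => //; exists 0; rewrite ?scale0r ?addr0//; exact: conic_span0.
have [->|xa] := pselect (x = a).
  by exists (c + p); rewrite ?addr_ge0//; exists w' => //; rewrite scalerDl addrA.
exists p => //; exists (c *: x + w'); last by rewrite addrCA.
by apply: conic_spanD w'X; apply: conic_spanZ => //; apply: conic_span_mem.
Qed.

End Spans.

Lemma lin_span_image (R : realType) (V E : lmodType R) (f : {linear V -> E})
  (X : set V) v : lin_span X v -> lin_span (f @` X) (f v).
Proof.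
elim/lin_span_ind=> [|c x w Xx _ IH]; first by rewrite linear0; exact: lin_span0.
rewrite linearP; apply: lin_spanD IH.
by apply/lin_spanZ/lin_span_mem; exists x.
Qed.

Lemma conic_span_image (R : realType) (V E : lmodType R) (f : {linear V -> E})
  (X : set V) v : conic_span X v -> conic_span (f @` X) (f v).
Proof.
elim/conic_span_ind=> [|c x w c0 Xx _ IH]; first by rewrite linear0; exact: conic_span0.
rewrite linearP; apply: conic_spanD IH.
by apply: conic_spanZ => //; apply: conic_span_mem; exists x.
Qed.

(** * Reflections and words in reflections *)

(** The product [s_a1 ... s_an] of the reflections along a list of vectors. *)
Definition act (R : realType) (V : lmodType R) (B : {symmetric V}) (s : seq V) :
    V -> V :=
  foldr (fun a f => sym_refl B a \o f) id s.

(** Lists with all their elements in [X]. *)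
Definition word (T : eqType) (X : set T) (s : seq T) : Prop :=
  forall x, x \in s -> X x.

Section Words.
Context (T : eqType).
Implicit Types (X Y : set T) (s : seq T).

Lemma word_nil X : word X [::]. Proof. by []. Qed.

Lemma word_cons X a s : word X (a :: s) <-> X a /\ word X s.
Proof.
split=> [h|[Xa h] x]; last by rewrite inE => /orP[/eqP->|/h].
by split=> [|x xs]; apply: h; rewrite inE ?eqxx ?xs ?orbT.
Qed.

Lemma word_cat X s1 s2 : word X (s1 ++ s2) <-> word X s1 /\ word X s2.
Proof.
split=> [h|[h1 h2] x]; last by rewrite mem_cat => /orP[/h1|/h2].
by split=> x xs; apply: h; rewrite mem_cat xs ?orbT.
Qed.

Lemma word_rev X s : word X s -> word X (rev s).
Proof. by move=> h x; rewrite mem_rev; apply: h. Qed.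

Lemma word_sub X Y s : X `<=` Y -> word X s -> word Y s.
Proof. by move=> XY h x /h/XY. Qed.

End Words.

Section Reflections.
Context (R : realType) (V : lmodType R) (B : {symmetric V}).
Implicit Types (X Y : set V) (u v x y a b : V) (s t : seq V).

Lemma bilC u v : B u v = B v u.
Proof. by rewrite hermC /= expr0 mul1r. Qed.

Lemma bilZl c u v : B (c *: u) v = c * B u v.
Proof. by rewrite linearZl_LR. Qed.

Lemma bilZr c u v : B u (c *: v) = c * B u v.
Proof. by rewrite bilC bilZl bilC. Qed.

Lemma bilDl u v w : B (u + v) w = B u w + B v w.
Proof. exact: linearDl. Qed.

Lemma bilNl u w : B (- u) w = - B u w.
Proof. exact: linearNl. Qed.

Lemma bilBl u v w : B (u - v) w = B u w - B v w.
Proof. by rewrite bilDl bilNl. Qed.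

Lemma bilBr u v w : B u (v - w) = B u v - B u w.
Proof. by rewrite bilC bilBl !(bilC u). Qed.

Lemma bilNr u w : B u (- w) = - B u w.
Proof. by rewrite bilC bilNl bilC. Qed.

Lemma sym_reflE a v : B a a = 1 -> sym_refl B a v = v - (2 * B v a) *: a.
Proof. by rewrite /sym_refl => ->; rewrite divr1. Qed.

Lemma sym_reflP a c u v :
  sym_refl B a (c *: u + v) = c *: sym_refl B a u + sym_refl B a v.
Proof.
rewrite /sym_refl bilDl bilZl scalerBr scalerA addrACA -opprD -scalerDl.
by congr (_ - _ *: _); ring.
Qed.

Lemma sym_refl0 a : sym_refl B a 0 = 0.
Proof. by rewrite /sym_refl linear0l mulr0 mul0r scale0r subr0. Qed.

Lemma sym_reflZ a c u : sym_refl B a (c *: u) = c *: sym_refl B a u.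
Proof. by have := sym_reflP a c u 0; rewrite !addr0 sym_refl0 addr0. Qed.

Lemma sym_reflD a u v : sym_refl B a (u + v) = sym_refl B a u + sym_refl B a v.
Proof. by have := sym_reflP a 1 u v; rewrite !scale1r. Qed.

Lemma sym_reflN a u : sym_refl B a (- u) = - sym_refl B a u.
Proof. by rewrite -scaleN1r sym_reflZ scaleN1r. Qed.

Lemma sym_refl_self a : B a a = 1 -> sym_refl B a a = - a.
Proof. by move=> a1; rewrite sym_reflE // a1 mulr1 scaler_nat mulr2n opprD addNKr. Qed.

Lemma sym_reflK a : B a a = 1 -> involutive (sym_refl B a).
Proof.
move=> a1 v; rewrite [X in sym_refl B a X]sym_reflE// -scaleNr addrC sym_reflP.
by rewrite sym_refl_self// sym_reflE// scalerN scaleNr opprK addrCA subrr addr0.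
Qed.

Lemma sym_refl_isom a u v : B a a = 1 ->
  B (sym_refl B a u) (sym_refl B a v) = B u v.
Proof.
move=> a1; rewrite !sym_reflE// bilBl !bilBr !bilZl !bilZr a1.
by rewrite (bilC a v); ring.
Qed.

Lemma sym_refl_conj a b v : B a a = 1 ->
  sym_refl B (sym_refl B a b) v = sym_refl B a (sym_refl B b (sym_refl B a v)).
Proof.
move=> a1; have E c w : sym_refl B c w = w - (2 * B w c / B c c) *: c by [].
rewrite (E (sym_refl B a b)) (E b) sym_reflD sym_reflN sym_reflZ sym_reflK//.
by rewrite sym_refl_isom// -[in RHS](sym_refl_isom _ _ a1) sym_reflK.
Qed.

Lemma sym_refl_opp a : sym_refl B (- a) = sym_refl B a.
Proof.
apply/funext => v; rewrite /sym_refl bilNr bilNl bilNr opprK.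
by rewrite mulrN mulNr scaleNr scalerN opprK.
Qed.

Lemma act_cons a s v : act B (a :: s) v = sym_refl B a (act B s v).
Proof. by []. Qed.

Lemma act_cat s t v : act B (s ++ t) v = act B s (act B t v).
Proof. by elim: s => //= a s <-. Qed.

Lemma act_rcons s a v : act B (rcons s a) v = act B s (sym_refl B a v).
Proof. by rewrite -cats1 act_cat. Qed.

Lemma actP s c u v : act B s (c *: u + v) = c *: act B s u + act B s v.
Proof. by elim: s => //= a s ->; rewrite sym_reflP. Qed.

Lemma act0 s : act B s 0 = 0.
Proof. by elim: s => //= a s ->; rewrite sym_refl0. Qed.

Lemma actZ s c u : act B s (c *: u) = c *: act B s u.
Proof. by have := actP s c u 0; rewrite !addr0 act0 addr0. Qed.

Lemma actD s u v : act B s (u + v) = act B s u + act B s v.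
Proof. by have := actP s 1 u v; rewrite !scale1r. Qed.

Lemma actN s u : act B s (- u) = - act B s u.
Proof. by rewrite -scaleN1r actZ scaleN1r. Qed.

(** Sets of vectors of norm one, for which [sym_refl] takes a polynomial form. *)
Definition unit_set X := forall a, X a -> B a a = 1.

Section UnitWords.
Context (X : set V) (X1 : unit_set X).

Lemma act_isom s u v : word X s -> B (act B s u) (act B s v) = B u v.
Proof.
elim: s => //= a s IH /word_cons[Xa /IH <-].
by rewrite sym_refl_isom//; exact: X1.
Qed.

Lemma actK s : word X s -> cancel (act B s) (act B (rev s)).
Proof.
elim: s => //= a s IH /word_cons[Xa /IH sK] v.
by rewrite rev_cons act_rcons sym_reflK ?sK//; exact: X1.
Qed.

Lemma actKV s : word X s -> cancel (act B (rev s)) (act B s).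
Proof. by move=> /word_rev/actK; rewrite revK. Qed.

Lemma sym_refl_actJ s a v : word X s ->
  sym_refl B (act B s a) (act B s v) = act B s (sym_refl B a v).
Proof.
elim: s => //= b s IH /word_cons[/X1 b1 /IH <-].
by rewrite sym_refl_conj// sym_reflK.
Qed.

Lemma act_map s t v : word X s ->
  act B s (act B t v) = act B (map (act B s) t) (act B s v).
Proof. by move=> sX; elim: t => //= a t <-; rewrite sym_refl_actJ. Qed.

Lemma sym_refl_act s a : word X s ->
  sym_refl B (act B s a) = act B (s ++ a :: rev s).
Proof.
move=> sX; apply/funext => v; rewrite act_cat act_cons -sym_refl_actJ//.
by rewrite actKV.
Qed.

End UnitWords.

Lemma gen_group_sub (A : Type) (X : set (A -> A)) : X `<=` gen_group X.
Proof. exact: sub_gen_smallest. Qed.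

Lemma gen_group_min (A : Type) (X G : set (A -> A)) :
  transf_group G -> X `<=` G -> gen_group X `<=` G.
Proof. exact: smallest_sub. Qed.

Lemma act_group X : unit_set X ->
  transf_group [set act B s | s in [set s | word X s]].
Proof.
move=> X1; split.
- by exists [::].
- move=> _ _ [s sX <-] [t tX <-]; exists (s ++ t); first by apply/word_cat.
  by apply/funext => v; rewrite act_cat.
- move=> _ [s sX <-]; exists (act B (rev s)); first by exists (rev s) => //; exact: word_rev.
  by split; [exact: (actK X1)|exact: (actKV X1)].
Qed.

(** The elements of a group generated by reflections are the words in them. *)
Lemma refl_groupE X : unit_set X ->
  refl_group B X = [set act B s | s in [set s | word X s]].
Proof.
move=> X1; apply/seteqP; split.
  apply: gen_group_min; first exact: act_group.
  by move=> _ [a Xa <-]; exists [:: a] => // x; rewrite inE => /eqP->.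
move=> _ [s sX <-] G [[G1 GM _] XG].
elim: s sX => [|a s IH] //= /word_cons[Xa sX]; apply: GM; last exact: IH.
by apply: XG; exists a.
Qed.

Lemma refl_groupS X Y : X `<=` Y -> refl_group B X `<=` refl_group B Y.
Proof.
by move=> XY f h G [gG YG]; apply: h; split=> // _ [a /XY Ya <-]; apply: YG; exists a.
Qed.

Lemma refl_group_mem X a : X a -> refl_group B X (sym_refl B a).
Proof. by move=> Xa; apply: gen_group_sub; exists a. Qed.

Lemma refl_group_transf X : unit_set X -> transf_group (refl_group B X).
Proof. by move=> X1; rewrite refl_groupE//; exact: act_group. Qed.

Lemma refl_group_min X (G : set (V -> V)) : transf_group G ->
  (forall a, X a -> G (sym_refl B a)) -> refl_group B X `<=` G.
Proof. by move=> gG XG; apply: gen_group_min => // _ [a /XG ? <-]. Qed.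

Lemma refl_group_act X s : word X s -> refl_group B X (act B s).
Proof.
move=> sX G [[G1 GM _] XG]; elim: s sX => [|a s IH] //= /word_cons[Xa sX].
by apply: GM; [apply: XG; exists a|exact: IH].
Qed.

(** If [f] transforms reflections as the identity does, and if a reflection
    [s_b] is a product of reflections [s_x] with [x] in [X], then
    [- 2 f b = f (s_b b) - f b] is a linear combination of the [f x]. *)
Lemma refl_group_span (E : lmodType R) (f : V -> E) (Y X : set V) b :
  unit_set Y -> (forall x y, Y x -> Y y -> Y (sym_refl B x y)) ->
  (forall x y, Y x -> Y y -> f (sym_refl B x y) = f y - (2 * B y x) *: f x) ->
  X `<=` Y -> Y b -> refl_group B X (sym_refl B b) -> lin_span (f @` X) (f b).
Proof.
move=> Y1 Yrefl frefl XY Yb.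
rewrite refl_groupE; last by move=> x /XY/Y1.
move=> -[s /= sX sE].
have h v : Y v -> Y (act B s v) /\ lin_span (f @` X) (f (act B s v) - f v).
  elim: s sX {sE} => [|a s IH] /=.
    by rewrite subrr => _ Yv; split=> //; exact: lin_span0.
  move=> /word_cons[Xa sX] Yv; have [Ysv spv] := IH sX Yv.
  split; first by apply: Yrefl => //; exact: XY.
  rewrite frefl//; last exact: XY.
  rewrite addrAC; apply: lin_spanB => //.
  by apply/lin_spanZ/lin_span_mem; exists a.
have [_] := h b Yb; rewrite sE frefl// Y1// mulr1.
rewrite addrAC subrr add0r => /(lin_spanZ (- 2^-1)).
by rewrite scalerN scaleNr opprK scalerA mulVf ?scale1r// pnatr_eq0.
Qed.

End Reflections.

(** * Positive roots, exchange and depth *)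

Section BasedRootSystem.
Context (R : realType) (V : lmodType R) (B : {symmetric V}).
Context (rs : basedRootSystem B).
Implicit Types (u v x y a b r : V) (s t : seq V).
Notation P := (simple_roots rs).
Notation F := (root_set rs).
Notation C := (conic_span P).

Lemma simple_unit : unit_set B P.
Proof. exact: simple_norm1. Qed.

Lemma root_setP b : F b <-> exists2 s, word P s & exists2 a, P a & b = act B s a.
Proof.
rewrite rootsE; split.
  move=> [w]; rewrite /mkset refl_groupE; last exact: simple_unit.
  by move=> [s sP <-] [a Pa <-]; exists s => //; exists a.
move=> [s sP [a Pa ->]]; exists (act B s); first exact: refl_group_act.
by exists a.
Qed.

Lemma simple_root a : P a -> F a.
Proof. by move=> Pa; apply/root_setP; exists [::] => //; exists a. Qed.

Lemma root_norm1 b : F b -> B b b = 1.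
Proof.
by move=> /root_setP[s sP [a Pa ->]]; rewrite (act_isom simple_unit)// (simple_unit Pa).
Qed.

Lemma root_unit : unit_set B F.
Proof. exact: root_norm1. Qed.

Lemma root_neq0 b : F b -> b <> 0.
Proof. by move=> /root_norm1 + b0; rewrite b0 linear0l => /esym/eqP; rewrite oner_eq0. Qed.

Lemma root_refl_word b : F b -> exists2 s, word P s & sym_refl B b = act B s.
Proof.
move=> /root_setP[s sP [a Pa ->]]; exists (s ++ a :: rev s).
  by apply/word_cat; split=> //; apply/word_cons; split=> //; exact: word_rev.
by rewrite (sym_refl_act simple_unit).
Qed.

Lemma root_act_simple s b : word P s -> F b -> F (act B s b).
Proof.
move=> sP /root_setP[t tP [a Pa ->]]; apply/root_setP.
by exists (s ++ t); [apply/word_cat|exists a; rewrite ?act_cat].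
Qed.

Lemma root_refl a b : F a -> F b -> F (sym_refl B a b).
Proof. by move=> /root_refl_word[s sP ->]; exact: root_act_simple. Qed.

Lemma root_opp b : F b -> F (- b).
Proof. by move=> Fb; rewrite -(sym_refl_self (root_norm1 Fb)); apply: root_refl. Qed.

Lemma root_refl_cox b : F b -> coxeter_group rs (sym_refl B b).
Proof. by move=> /root_refl_word[s sP ->]; exact: refl_group_act. Qed.

Lemma cone_pointed v : C v -> C (- v) -> v = 0.
Proof.
move=> Cv /conic_spanN Cv'; have : [set 0] v by rewrite -(cone_simple_pointed rs).
by [].
Qed.

Lemma root_sign b : F b -> C b \/ C (- b).
Proof.
by rewrite {1}roots_pos_neg => -[[_ ?]|[_ /conic_spanN ?]]; [left|right].
Qed.

Lemma root_npos b : F b -> C b -> ~ C (- b).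
Proof. by move=> Fb Cb /(cone_pointed Cb); exact: root_neq0. Qed.

(** A simple root spans an extremal ray of the cone of the simple roots. *)
Lemma simple_ray a c x y : P a -> C x -> C y -> x + y = c *: a ->
  exists2 p, 0 <= p & x = p *: a.
Proof.
move=> Pa /(conic_span_split a)[p p0 [x' Cx' ->]] /(conic_span_split a)[q q0 [y' Cy' ->]].
move=> e; have {}e : x' + y' = (c - p - q) *: a.
  by apply/eqP; rewrite !scalerBl eq_sym !subr_eq -e [X in X == _](AC (2*2) (2*4*3*1)).
exists p => //; suff -> : x' = 0 by rewrite addr0.
have sub : conic_span (P `\ a) `<=` C.
  by apply: conic_span_sub => z [Pz _]; exact: conic_span_mem.
have [c0|c0] := ltP 0 (c - p - q).
  case: (simple_notin_cone Pa).
  have aE : (c - p - q)^-1 *: (x' + y') = a.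
    by rewrite e scalerA mulVf ?scale1r// gt_eqF.
  by rewrite -[X in conic_span _ X]aE; apply: conic_spanZ;
    [rewrite invr_ge0 ltW|exact: conic_spanD].
apply: cone_pointed; first exact: sub.
have -> : - x' = y' + (- (c - p - q)) *: a by rewrite scaleNr -e opprD addrCA subrr addr0.
apply: conic_spanD; first exact: sub.
by apply: conic_spanZ; [rewrite oppr_ge0|exact: conic_span_mem].
Qed.

Lemma root_ray a b p : F a -> F b -> 0 <= p -> b = p *: a -> b = a.
Proof.
move=> /root_norm1 a1 /root_norm1 + p0 bE.
rewrite bE bilZl bilZr a1 mulr1 -expr2 => /eqP; rewrite sqrp_eq1// => /eqP->.
by rewrite scale1r.
Qed.

(** A simple reflection permutes the positive roots other than its own. *)
Lemma simple_refl_pos a b : P a -> F b -> C b -> b <> a -> C (sym_refl B a b).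
Proof.
move=> Pa Fb Cb ba; have Fa := simple_root Pa.
have [//|Cn] := root_sign (root_refl Fa Fb).
have [|p p0 bE] := simple_ray (c := 2 * B b a) Pa Cb Cn.
  by rewrite sym_reflE ?(simple_unit Pa)// opprB addrC subrK.
by case: ba; apply: root_ray bE.
Qed.

(** Exchange condition: if [b] is a positive root and [w^-1 b] is negative, then
    [s_b w] has an expression shorter than the given one of [w]. *)
Lemma strong_exchange s b : word P s -> F b -> C b -> C (- act B (rev s) b) ->
  exists t, [/\ word P t, (size t < size s)%N
              & forall v, act B t v = sym_refl B b (act B s v)].
Proof.
elim: s b => [|a s IH] b sP Fb Cb; first by move/(root_npos Fb Cb).
move/word_cons: sP => [Pa sP]; have Fa := simple_root Pa.
rewrite rev_cons act_rcons => Cn.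
have [ba|ba] := pselect (b = a).
  by exists s; split=> // v; rewrite act_cons ba (sym_reflK (root_norm1 Fa)).
have [t [tP ts tE]] := IH _ sP (root_refl Fa Fb) (simple_refl_pos Pa Fb Cb ba) Cn.
exists (a :: t); split=> //; first by apply/word_cons.
by move=> v; rewrite !act_cons tE sym_refl_conj ?sym_reflK//; exact: root_norm1.
Qed.

(** The same on the right, for a simple reflection. *)
Lemma exchange s a : word P s -> P a -> C (- act B s a) ->
  exists t, [/\ word P t, (size t < size s)%N & act B t = act B (rcons s a)].
Proof.
move=> sP Pa Cn; have Fa := simple_root Pa.
have [|t [tP ts tE]] := strong_exchange (word_rev sP) Fa (conic_span_mem Pa).
  by rewrite revK.
exists (rev t); split; [exact: word_rev|by rewrite size_rev -(size_rev s)|].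
apply/funext => v; apply: (can_inj (actK simple_unit tP)).
rewrite (actKV simple_unit tP).
by rewrite tE act_rcons (actK simple_unit sP) (sym_reflK (root_norm1 Fa)).
Qed.

Lemma conic_form_gt0 X b : conic_span X b -> B b b = 1 -> exists2 x, X x & 0 < B b x.
Proof.
move=> Xb b1; apply: contrapT => nX.
suff : B b b <= 0 by rewrite b1 leNgt ltr01.
move: {1 3}b Xb; apply: conic_span_ind => [|c x v c0 Xx _ v0]; first by rewrite linear0r.
rewrite bilC bilDl bilZl !(bilC B _ b) -[leRHS]addr0 lerD// mulr_ge0_le0//.
by rewrite leNgt; apply/negP => bx; apply: nX; exists x.
Qed.

(** Some word of length at most [n] sends [b] to a negative root; the least such
    [n] is the depth of [b]. *)
Definition lowers n b := exists2 s, word P s /\ (size s <= n)%N & C (- act B s b).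

Lemma lowers_ex b : F b -> exists n, lowers n b.
Proof.
move=> /root_setP[s sP [a Pa ->]]; exists (size s).+1, (a :: rev s).
  by split; [apply/word_cons; split=> //; exact: word_rev|rewrite /= size_rev].
rewrite act_cons (actK simple_unit)// sym_refl_self ?(simple_unit Pa)// opprK.
exact: conic_span_mem.
Qed.

(** A simple reflection [s_r] with [B b r] positive decreases the depth of [b]. *)
Lemma lowers_refl n r b : P r -> F b -> C b -> b <> r -> 0 < B b r ->
  lowers n b -> exists2 m, (m < n)%N & lowers m (sym_refl B r b).
Proof.
move=> Pr Fb Cb br Bbr nb.
have [|n0 + n0_min] := @ex_minnP (fun n => `[< lowers n b >]); first by exists n; apply/asboolP.
move=> /asboolP[s [sP sn0] Csb]; have n0n : (n0 <= n)%N by apply: n0_min; apply/asboolP.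
have {n0_min} n0_min m : (m < n0)%N -> ~ lowers m b.
  by move=> mn0 /asboolP/n0_min; rewrite leqNgt mn0.
have Fr := simple_root Pr; have r1 := simple_norm1 Pr.
(* [s] is a shortest word making [b] negative; if it makes [r] negative as well,
   exchange gives a shorter word for [s s_r], which sends [s_r b] to [s b]. *)
have [Csr|/(exchange sP Pr)[t [tP ts tE]]] := root_sign (root_act_simple sP Fr); last first.
  exists (size t); first by rewrite (leq_trans ts)// (leq_trans sn0).
  by exists t => //; rewrite tE act_rcons sym_reflK.
case: s sP sn0 Csb Csr => [|a s] sP sn0 Csb Csr; first by case: (root_npos Fb Cb).
move/word_cons: sP => [Pa sP].
have Fsb := root_act_simple sP Fb; have Fsr := root_act_simple sP Fr.
have Fa := simple_root Pa.
(* Otherwise the first letter [a] can be dropped: the rest of the word sends [b]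
   to [a] and [s_r b] to [a] minus a positive multiple of a positive root. *)
have sba : act B s b = a.
  have [Csb'|Cn] := root_sign Fsb; last by case: (n0_min (size s) sn0); exists s.
  apply: contrapT => /(simple_refl_pos Pa Fsb Csb').
  by move=> /(root_npos (root_refl Fa Fsb)).
have inj := can_inj (actK simple_unit sP).
have {}Csr : C (act B s r).
  have [//|Cn] := root_sign Fsr.
  have e : - act B s r = a.
    apply: contrapT => /(simple_refl_pos Pa (root_opp Fsr) Cn).
    by rewrite sym_reflN => /(root_npos (root_refl Fa Fsr) Csr).
  case: (root_npos Fb Cb); have -> : - b = r; last exact: conic_span_mem.
  by apply: inj; rewrite actN sba -e opprK.
exists (size s); first exact: leq_trans sn0 n0n.
exists s => //; have Fsrb := root_act_simple sP (root_refl Fr Fb).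
have [Cp|//] := root_sign Fsrb.
have c0 : 0 < 2 * B b r by rewrite mulr_gt0.
have [|p p0 pE] := simple_ray (c := 1) Pa (conic_spanZ (ltW c0) Csr) Cp.
  by rewrite sym_reflE// actD actN actZ sba addrC subrK scale1r.
case: br; apply: inj; rewrite sba; apply/esym.
apply: (root_ray (p := (2 * B b r)^-1 * p)) => //.
  by rewrite mulr_ge0// invr_ge0 ltW.
by rewrite -scalerA -pE scalerA mulVf ?scale1r// gt_eqF.
Qed.

(** Induction on the depth of a positive root. *)
Lemma depth_ind (Q : V -> Prop) :
  (forall b, F b -> C b ->
     (forall r, P r -> b <> r -> 0 < B b r -> Q (sym_refl B r b)) -> Q b) ->
  forall b, F b -> C b -> Q b.
Proof.
move=> IH b Fb; have [n nb] := lowers_ex Fb.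
elim/ltn_ind: n b Fb nb => n IHn b Fb nb Cb; apply: IH => // r Pr br Bbr.
have [m mn mb] := lowers_refl Pr Fb Cb br Bbr nb.
apply: (IHn m) => //; first by apply: root_refl => //; exact: simple_root.
exact: simple_refl_pos.
Qed.

End BasedRootSystem.

(** * Lifting a root system *)

Section Lift.
Context (R : realType) (V : lmodType R) (B : {symmetric V}).
Context (rs : basedRootSystem B).
Context (E : lmodType R) (pi : {linear E -> V}) (e : V -> E).
Hypothesis pi_e : forall a, simple_roots rs a -> pi (e a) = a.
Implicit Types (u v a b r : V) (x y : E) (s t : seq V).
Notation P := (simple_roots rs).
Notation F := (root_set rs).
Notation C := (conic_span P).
Notation P1 := (@simple_unit _ _ _ rs).
Notation LC := (conic_span (e @` P)).

(** The reflection of [E] above the simple reflection [s_r]. *)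
Definition lift_refl r x := x - (2 * B (pi x) r) *: e r.

(** The product of the reflections of [E] above a word in the simple reflections. *)
Definition lift_act s := foldr (fun r f => lift_refl r \o f) id s.

Lemma lift_reflP r c x y :
  lift_refl r (c *: x + y) = c *: lift_refl r x + lift_refl r y.
Proof.
rewrite /lift_refl linearP bilDl bilZl scalerBr scalerA addrACA -opprD -scalerDl.
by congr (_ - _ *: _); ring.
Qed.

Lemma pi_lift_refl r x : P r -> pi (lift_refl r x) = sym_refl B r (pi x).
Proof.
move=> Pr; rewrite /lift_refl linearB linearZ_LR/= pi_e//.
by rewrite (sym_reflE _ (simple_unit Pr)).
Qed.

Lemma lift_reflK r : P r -> involutive (lift_refl r).
Proof.
move=> Pr x; rewrite {1}/lift_refl pi_lift_refl// sym_reflE ?(simple_unit Pr)//.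
rewrite bilBl bilZl (simple_unit Pr) /lift_refl -addrA -opprD -scalerDl.
by rewrite (_ : _ + _ = 0 :> R) ?scale0r ?subr0//; ring.
Qed.

Lemma lift_refl_e r : P r -> lift_refl r (e r) = - e r.
Proof.
move=> Pr; rewrite /lift_refl pi_e// (simple_unit Pr) mulr1 scaler_nat mulr2n.
by rewrite opprD addNKr.
Qed.

Lemma lift_act_cons r s x : lift_act (r :: s) x = lift_refl r (lift_act s x).
Proof. by []. Qed.

Lemma lift_act_cat s t x : lift_act (s ++ t) x = lift_act s (lift_act t x).
Proof. by elim: s => //= a s <-. Qed.

Lemma lift_act_rcons s r x : lift_act (rcons s r) x = lift_act s (lift_refl r x).
Proof. by rewrite -cats1 lift_act_cat. Qed.

Lemma lift_actP s c x y : lift_act s (c *: x + y) = c *: lift_act s x + lift_act s y.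
Proof. by elim: s => //= a s ->; rewrite lift_reflP. Qed.

Lemma lift_actD s x y : lift_act s (x + y) = lift_act s x + lift_act s y.
Proof. by have := lift_actP s 1 x y; rewrite !scale1r. Qed.

Lemma lift_act0 s : lift_act s 0 = 0.
Proof.
by apply: (addrI (lift_act s 0)); rewrite -lift_actD !addr0.
Qed.

Lemma lift_actZ s c x : lift_act s (c *: x) = c *: lift_act s x.
Proof. by have := lift_actP s c x 0; rewrite !addr0 lift_act0 addr0. Qed.

Lemma lift_actN s x : lift_act s (- x) = - lift_act s x.
Proof. by rewrite -scaleN1r lift_actZ scaleN1r. Qed.

Lemma pi_lift_act s x : word P s -> pi (lift_act s x) = act B s (pi x).
Proof. by elim: s => //= a s IH /word_cons[Pa /IH <-]; rewrite pi_lift_refl. Qed.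

Lemma lift_actK s : word P s -> cancel (lift_act s) (lift_act (rev s)).
Proof.
elim: s => //= a s IH /word_cons[Pa /IH sK] x.
by rewrite rev_cons lift_act_rcons lift_reflK ?sK.
Qed.

Lemma lift_actKV s : word P s -> cancel (lift_act (rev s)) (lift_act s).
Proof. by move=> /word_rev/lift_actK; rewrite revK. Qed.

(** The reflection of [E] above a root [s a]. *)
Lemma lift_act_conj s a x : word P s -> P a ->
  lift_act (s ++ a :: rev s) x = x - (2 * B (pi x) (act B s a)) *: lift_act s (e a).
Proof.
move=> sP Pa; rewrite lift_act_cat lift_act_cons /lift_refl.
rewrite -scaleNr lift_actD lift_actZ lift_actKV// scaleNr.
rewrite pi_lift_act; last exact: word_rev.
by rewrite -(act_isom P1 _ _ sP) (actKV P1).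
Qed.

(** ** Rank two *)

Section Dihedral.
Context (a b : V).
Hypotheses (Pa : P a) (Pb : P b) (ab : a <> b).

Lemma simple_pair_free p q : p *: a + q *: b = 0 -> p = 0 /\ q = 0.
Proof.
have Fa := simple_root Pa; have Fb := simple_root Pb.
have [->|p0] := eqVneq p 0.
  rewrite scale0r add0r => /eqP; rewrite scaler_eq0 => /orP[/eqP->//|/eqP].
  by move/(root_neq0 Fb).
move=> /eqP; rewrite addr_eq0 => /eqP paE.
have {paE} aE : a = (- (p^-1 * q)) *: b.
  by rewrite scaleNr -scalerA -scalerN -paE scalerA mulVf// scale1r.
have [k0|k0] := leP 0 (- (p^-1 * q)); first by case: ab; exact: (root_ray Fb Fa k0 aE).
case: (root_npos Fa (conic_span_mem Pa)).
by rewrite aE -scaleNr; apply: conic_spanZ; [rewrite oppr_ge0 ltW|exact: conic_span_mem].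
Qed.

Lemma conic_pair p q : 0 <= p -> 0 <= q -> C (p *: a + q *: b).
Proof. by move=> p0 q0; apply: conic_spanD; apply: conic_spanZ => //; exact: conic_span_mem. Qed.

Lemma pos_root_pair_coef p q : F (p *: a + q *: b) -> C (p *: a + q *: b) -> 0 <= p.
Proof.
move=> Fpq Cpq; rewrite leNgt; apply/negP => p0.
have [q0|q0] := leP q 0.
  apply: (root_npos Fpq Cpq); rewrite opprD -!scaleNr.
  by apply: conic_pair; rewrite oppr_ge0// ltW.
have p0' : 0 <= - p by rewrite oppr_ge0 ltW.
have [|k k0 kE] := simple_ray (c := q) Pb (conic_spanZ p0' (conic_span_mem Pa)) Cpq.
  by rewrite scaleNr addKr.
apply: ab; apply: (root_ray (p := (- p)^-1 * k) (simple_root Pb) (simple_root Pa)).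
  by rewrite mulr_ge0// invr_ge0.
by rewrite -scalerA -kE scalerA mulVf ?scale1r// oppr_eq0 lt_eqF.
Qed.

End Dihedral.

(** The sign of a root in the plane of two simple roots is that of its coordinates,
    although [Pi] need not be linearly independent. *)
Lemma root_pair_coef a b p q : P a -> P b -> a <> b -> F (p *: a + q *: b) ->
  0 <= p /\ 0 <= q \/ p <= 0 /\ q <= 0.
Proof.
move=> Pa Pb ab.
have pos p' q' : F (p' *: a + q' *: b) -> C (p' *: a + q' *: b) -> 0 <= p' /\ 0 <= q'.
  move=> Fpq Cpq; split; first exact: pos_root_pair_coef Fpq Cpq.
  by move: Fpq Cpq; rewrite addrC => Fpq Cpq; apply: pos_root_pair_coef Fpq Cpq => // /esym.
move=> Fpq; have [/(pos _ _ Fpq)|] := root_sign Fpq; first by left.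
move: (root_opp Fpq); rewrite opprD -!scaleNr => /pos/[apply].
by rewrite !oppr_ge0; right.
Qed.

Lemma lift_act_pair a b d c : P a -> P b -> word [set a; b] d -> [set a; b] c ->
  exists p q, lift_act d (e c) = p *: e a + q *: e b.
Proof.
move=> Pa Pb + cab; elim: d => [|g d IH].
  case: cab => ->; first by exists 1, 0; rewrite scale1r scale0r addr0.
  by exists 0, 1; rewrite scale1r scale0r add0r.
move=> /word_cons[gab /IH[p [q E1]]]; rewrite lift_act_cons E1 /lift_refl.
move: (2 * _) => k; case: gab => ->.
  by exists (p - k), q; rewrite scalerBl addrAC.
by exists p, (q - k); rewrite scalerBl addrA.
Qed.

Lemma word_pair a b d : P a -> P b -> word [set a; b] d -> word P d.
Proof. by move=> Pa Pb; apply: word_sub => x [->|->]. Qed.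

(** The exchange condition in [E] for a dihedral parabolic subgroup. *)
Lemma lift_dihedral_exchange a b d p q : P a -> P b -> a <> b ->
  word [set a; b] d -> lift_act d (e a) = p *: e a + q *: e b ->
  p <= 0 -> q <= 0 ->
  exists t, [/\ word [set a; b] t, (size t < size d)%N
              & lift_act t = lift_act (rcons d a)].
Proof.
move=> Pa Pb ab; have Fa := simple_root Pa.
elim: d p q => [|c d IH] p q dab dE p0 q0.
  have := congr1 pi dE; rewrite /= linearD !linearZ_LR/= !pi_e// => aE.
  case: (root_npos Fa (conic_span_mem Pa)); rewrite [X in C (- X)]aE.
  by rewrite opprD -!scaleNr; apply: conic_pair; rewrite ?oppr_ge0.
move/word_cons: dab => [cab dab].
have dP := word_pair Pa Pb dab.
have Pc : P c by case: cab => ->.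
have [p2 [q2 E2]] := lift_act_pair Pa Pb dab (or_introl erefl : [set a; b] a).
have piE2 : act B d a = p2 *: a + q2 *: b.
  by rewrite -[a in LHS]pi_e// -pi_lift_act// E2 linearD !linearZ_LR/= !pi_e.
have Fd : F (act B d a) by exact: root_act_simple.
have [[p20 q20]|[p20 q20]] : 0 <= p2 /\ 0 <= q2 \/ p2 <= 0 /\ q2 <= 0.
- by apply: root_pair_coef ab _ => //; rewrite -piE2.
- have dc : act B d a = c.
    apply: contrapT => dc; have Cd : C (act B d a) by rewrite piE2; exact: conic_pair.
    apply: (root_npos (root_refl (simple_root Pc) Fd) (simple_refl_pos Pc Fd Cd dc)).
    have -> : sym_refl B c (act B d a) = p *: a + q *: b.
      rewrite -[a in LHS]pi_e// -pi_lift_act// -pi_lift_refl// -lift_act_cons dE.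
      by rewrite linearD !linearZ_LR/= !pi_e.
    by rewrite opprD -!scaleNr; apply: conic_pair; rewrite ?oppr_ge0.
  have lc : lift_act d (e a) = e c.
    rewrite E2; move: piE2; rewrite dc; case: cab => ->.
      move=> /eqP; rewrite -subr_eq0 opprD addrA -{1}[a]scale1r -scalerBl -scaleNr => /eqP.
      move=> /(simple_pair_free Pa Pb ab)[/eqP + /eqP].
      by rewrite subr_eq0 oppr_eq0 => /eqP<- /eqP->; rewrite scale0r addr0 scale1r.
    move=> /eqP; rewrite -subr_eq0 opprD addrCA -{1}[b]scale1r -scalerBl -scaleNr => /eqP.
    move=> /(simple_pair_free Pa Pb ab)[/eqP + /eqP].
    by rewrite subr_eq0 oppr_eq0 => /eqP-> /eqP<-; rewrite scale0r add0r scale1r.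
  exists d; split=> //; apply/funext => x.
  rewrite lift_act_rcons lift_act_cons -{1}[x](lift_reflK Pa).
  move: (lift_refl a x) => y; rewrite -[y in LHS](lift_actK dP).
  by rewrite -lift_act_cons -lift_act_cat lift_act_conj// dc lc.
- have [t [tab td tE]] := IH p2 q2 dab E2 p20 q20.
  exists (c :: t); split=> //; first by apply/word_cons.
  by apply/funext => x; rewrite lift_act_cons tE.
Qed.

(** ** The lifted positive system *)

(** The exchange condition and positivity are proved together, by induction on
    the length of the word: a word is factored through a dihedral parabolic
    subgroup with first factor as short as possible, and positivity in rank two
    is read off in [V], where two simple roots are linearly independent. *)
Lemma lift_pos_or_exchange s a : word P s -> P a ->
  LC (lift_act s (e a)) \/
  exists t, [/\ word P t, (size t < size s)%N & lift_act t = lift_act (rcons s a)].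
Proof.
move: (leqnn (size s)); move: {2}(size s) => n.
elim/ltn_ind: n s a => n IH s a sn sP Pa.
case/lastP: s sn sP => [|s1 b] sn sP; first by left; apply: conic_span_mem; exists a.
have [s1P Pb] : word P s1 /\ P b.
  by move: sP; rewrite -cats1 => /word_cat[? /word_cons[]].
have [<-|ba] := pselect (b = a).
  right; exists s1; rewrite size_rcons; split=> //.
  by apply/funext => x; rewrite !lift_act_rcons lift_reflK.
(* [Q m]: the word factors as [w d], without being longer, with [d] in the letters
   [a], [b] and [w] of length [m]. *)
pose Q m := exists w (d : seq V), [/\ word P w, word [set a; b] d,
  lift_act (rcons s1 b) = lift_act w \o lift_act d,
  (size w + size d <= size (rcons s1 b))%N & size w = m].
have [|m + m_min] := @ex_minnP (fun m => `[< Q m >]).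
  exists (size s1); apply/asboolP; exists s1, [:: b]; split=> //.
  - by apply/word_cons; split=> //; right.
  - by apply/funext => x; rewrite lift_act_rcons.
  - by rewrite size_rcons addn1.
move=> /asboolP[w [d [uP dab sE ud um]]].
have um1 : (size w < n)%N.
  apply: leq_trans sn; rewrite size_rcons ltnS um; apply: m_min; apply/asboolP.
  exists s1, [:: b]; split=> //.
  - by apply/word_cons; split=> //; right.
  - by apply/funext => x; rewrite lift_act_rcons.
  - by rewrite size_rcons addn1.
(* By minimality of [w], exchange cannot occur: a letter would move to [d]. *)
have upos c : [set a; b] c -> LC (lift_act w (e c)).
  move=> cab; have Pc : P c by case: cab => ->.
  have [//|[t [tP tu tE]]] := IH _ um1 w c (leqnn _) uP Pc.
  have : Q (size t).
    exists t, (c :: d); split=> //; first by apply/word_cons.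
      apply/funext => x; rewrite sE /= tE lift_act_rcons.
      by rewrite lift_reflK.
    by apply: leq_trans ud; rewrite /= addnS -addSn leq_add2r.
  by move=> /asboolP/m_min; rewrite leqNgt -um tu.
have ab : a <> b by move=> /esym.
have dP := word_pair Pa Pb dab.
have [p [q dE]] := lift_act_pair Pa Pb dab (or_introl erefl : [set a; b] a).
have Fd : F (p *: a + q *: b).
  rewrite (_ : _ + _ = act B d a); last first.
    by rewrite -[a in RHS]pi_e// -pi_lift_act// dE linearD !linearZ_LR/= !pi_e.
  by apply: root_act_simple => //; exact: simple_root.
have [[p0 q0]|[p0 q0]] := root_pair_coef Pa Pb ab Fd.
  left; rewrite sE /= dE lift_actP lift_actZ.
  by apply: conic_spanD; apply: conic_spanZ => //; apply: upos; [left|right].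
have [t [tab td tE]] := lift_dihedral_exchange Pa Pb ab dab dE p0 q0.
right; exists (w ++ t); split.
- by apply/word_cat; split=> //; exact: word_pair tab.
- by apply: leq_trans ud; rewrite size_cat ltn_add2l.
- by apply/funext => x; rewrite lift_act_cat tE !(lift_act_rcons _ a) sE.
Qed.

Lemma lift_sign s a : word P s -> P a ->
  LC (lift_act s (e a)) \/ LC (- lift_act s (e a)).
Proof.
move: (leqnn (size s)); move: {2}(size s) => n.
elim/ltn_ind: n s => n IH s sn sP Pa.
have [|[t [tP ts tE]]] := lift_pos_or_exchange sP Pa; first by left.
have := IH _ (leq_trans ts sn) t (leqnn _) tP Pa.
rewrite tE lift_act_rcons lift_refl_e// lift_actN opprK.
by case; [right|left].
Qed.

Lemma pi_lift_cone x : LC x -> C (pi x).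
Proof.
move=> /(conic_span_image pi); apply: conic_span_sub => _ [_ [a Pa <-] <-].
by rewrite pi_e//; exact: conic_span_mem.
Qed.

(** The projection has no kernel on the cone, since the cone of [Pi] is pointed. *)
Lemma lift_cone_inj0 x : LC x -> pi x = 0 -> x = 0.
Proof.
elim/conic_span_ind => // c _ {}x c0 [r Pr <-] LCx IH.
rewrite linearP pi_e// => h.
have cr0 : c *: r = 0.
  apply: (@cone_pointed _ _ _ rs); first by apply: conic_spanZ => //; exact: conic_span_mem.
  by move/eqP: h; rewrite addrC addr_eq0 => /eqP<-; exact: pi_lift_cone.
move: h; rewrite cr0 add0r => /IH->.
move/eqP: cr0; rewrite scaler_eq0 => /orP[/eqP->|/eqP]; first by rewrite scale0r addr0.
by move/(root_neq0 (simple_root Pr)).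
Qed.

(** The only vector of the lifted cone above a simple root [a] is [e a], because
    [a] is not a conic combination of the other simple roots. *)
Lemma lift_cone_simple x a : LC x -> P a -> pi x = a -> x = e a.
Proof.
move=> /(conic_span_split (e a))[p p0 [w wLC ->]] Pa.
rewrite linearD linearZ_LR/= pi_e// => aE.
have LCw : LC w by apply: conic_span_sub wLC => y [? _]; exact: conic_span_mem.
have Cw : conic_span (P `\ a) (pi w).
  move: (conic_span_image pi wLC); apply: conic_span_sub => _ [_ [[r Pr <-] ra] <-].
  by rewrite pi_e//; apply: conic_span_mem; split=> // ra'; apply: ra; rewrite ra'.
have {}aE : pi w = (1 - p) *: a by rewrite scalerBl scale1r -{1}aE addrAC subrr add0r.
have [p1|p1] := ltP 0 (1 - p).
  have q0 : 0 <= (1 - p)^-1 by rewrite invr_ge0 ltW.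
  case: (simple_notin_cone Pa); have := conic_spanZ q0 Cw.
  by rewrite aE scalerA mulVf ?scale1r// gt_eqF.
have w0 : pi w = 0.
  apply: (@cone_pointed _ _ _ rs); first exact: pi_lift_cone.
  by rewrite aE -scaleNr; apply: conic_spanZ; [rewrite oppr_ge0|exact: conic_span_mem].
move/eqP: aE; rewrite w0 (lift_cone_inj0 LCw w0) eq_sym scaler_eq0 addr0.
move=> /orP[|/eqP]; last by move/(root_neq0 (simple_root Pa)).
by rewrite subr_eq0 => /eqP<-; rewrite scale1r.
Qed.

Lemma lift_act_uniq s t a b : word P s -> word P t -> P a -> P b ->
  act B s a = act B t b -> lift_act s (e a) = lift_act t (e b).
Proof.
move=> sP tP Pa Pb stE; apply: (can_inj (lift_actK (word_rev tP))); rewrite lift_actK//.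
rewrite -lift_act_cat; have tsP : word P (rev t ++ s).
  by apply/word_cat; split=> //; exact: word_rev.
have piE : pi (lift_act (rev t ++ s) (e a)) = b.
  by rewrite pi_lift_act// pi_e// act_cat stE (actK P1).
have [LCx|/pi_lift_cone] := lift_sign tsP Pa; first exact: lift_cone_simple.
by rewrite linearN piE => /(root_npos (simple_root Pb) (conic_span_mem Pb)).
Qed.

(** The lift of a root: [w (e a)] for the root [w a]. Vectors that are not roots are
    sent to [0]. *)
Definition lift_root b : E :=
  xget 0 [set x | exists s a, [/\ word P s, P a, b = act B s a & x = lift_act s (e a)]].

Lemma liftE s a : word P s -> P a -> lift_root (act B s a) = lift_act s (e a).
Proof.
move=> sP Pa; rewrite /lift_root; case: xgetP => [x _ [t [b [tP Pb stE ->]]]|].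
  by apply: lift_act_uniq.
by move=> /(_ (lift_act s (e a)))[]; exists s, a.
Qed.

Lemma lift_simple a : P a -> lift_root a = e a.
Proof. by move=> Pa; have := @liftE [::] a; apply. Qed.

Lemma lift_act_root s b : word P s -> F b -> lift_root (act B s b) = lift_act s (lift_root b).
Proof.
move=> sP /root_setP[t tP [a Pa ->]].
rewrite -act_cat liftE//; last by apply/word_cat.
by rewrite lift_act_cat liftE.
Qed.

Lemma pi_lift b : F b -> pi (lift_root b) = b.
Proof. by move=> /root_setP[s sP [a Pa ->]]; rewrite liftE// pi_lift_act// pi_e. Qed.

Lemma lift_sym_refl a b : F a -> F b ->
  lift_root (sym_refl B a b) = lift_root b - (2 * B b a) *: lift_root a.
Proof.
move=> /root_setP[s sP [r Pr ->]] Fb.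
rewrite (sym_refl_act P1)//.
rewrite lift_act_root//; last first.
  by apply/word_cat; split=> //; apply/word_cons; split=> //; exact: word_rev.
by rewrite lift_act_conj// pi_lift// liftE.
Qed.

Lemma lift_pos b : F b -> C b -> LC (lift_root b).
Proof.
move=> Fb Cb; have [s sP [a Pa bE]] := (root_setP rs b).1 Fb.
have [|/pi_lift_cone] := lift_sign sP Pa; first by rewrite bE liftE.
by rewrite linearN -liftE// -bE pi_lift// => /(root_npos Fb Cb).
Qed.

Lemma lift_span (X : set V) b : X `<=` F -> F b -> refl_group B X (sym_refl B b) ->
  lin_span (lift_root @` X) (lift_root b).
Proof.
apply: refl_group_span; [exact: root_unit|exact: root_refl|exact: lift_sym_refl].
Qed.

End Lift.

(** * Reflection subgroups and their based root systems *)

Section Subsystems.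
Context (R : realType) (V : lmodType R) (B : {symmetric V}).
Context (rs : basedRootSystem B).
Implicit Types (u v x y a b r : V) (s t : seq V) (X Y : set V) (U : set (V -> V)).
Notation P := (simple_roots rs).
Notation F := (root_set rs).
Notation C := (conic_span P).

(** Sets of roots stable under their own reflections, such as the sets [Phi_U]. *)
Definition subsystem Y := Y `<=` F /\ forall a b, Y a -> Y b -> Y (sym_refl B a b).

(** The positive roots of [Y] whose reflection makes no other positive root
    of [Y] negative. *)
Definition subsystem_simple Y : set V :=
  [set a | [/\ Y a, C a & forall b, Y b -> C b -> b <> a -> C (sym_refl B a b)]].

Lemma subsystem_opp Y b : subsystem Y -> Y b -> Y (- b).
Proof.
by move=> [YF Yrefl] Yb; rewrite -(sym_refl_self (root_norm1 (YF _ Yb))); apply: Yrefl.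
Qed.

Lemma subsystem_simple_sub Y : subsystem_simple Y `<=` Y.
Proof. by move=> a []. Qed.

Lemma simple_sub_subsystem Y J : subsystem Y -> J `<=` P -> J `<=` Y ->
  J `<=` subsystem_simple Y.
Proof.
move=> [YF _] JP JY a Ja; split; [exact: JY|exact/conic_span_mem/JP|].
by move=> b /YF Fb Cb ba; apply: simple_refl_pos => //; exact: JP.
Qed.

Lemma subsystem_conj Y r : subsystem Y -> F r ->
  subsystem [set b | Y (sym_refl B r b)].
Proof.
move=> [YF Yrefl] Fr; have rK := sym_reflK (root_norm1 Fr).
have YF' b : Y (sym_refl B r b) -> F b.
  by move=> /YF /(root_refl Fr); rewrite rK.
split=> [b /YF'//|a b /= Ya Yb].
by have := Yrefl _ _ Ya Yb; rewrite sym_refl_conj ?rK ?(root_norm1 Fr).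
Qed.

(** Conjugation by a simple reflection [s_r] that is not in the subgroup preserves
    the positive system, since [r] is the only positive root that [s_r] makes
    negative. *)
Lemma subsystem_simple_conj Y r c : subsystem Y -> P r -> ~ Y r ->
  subsystem_simple [set b | Y (sym_refl B r b)] c ->
  subsystem_simple Y (sym_refl B r c).
Proof.
move=> hY Pr nYr [/= Yc Cc c_simple]; have Fr := simple_root Pr.
have rK := sym_reflK (root_norm1 Fr); have [YF Yrefl] := hY.
have Fc : F c by rewrite -[c]rK; apply: root_refl => //; exact: YF.
have nYr' : ~ Y (sym_refl B r r).
  by rewrite (sym_refl_self (root_norm1 Fr)) => /(subsystem_opp hY); rewrite opprK.
split=> //; first by apply: simple_refl_pos => // cr; apply: nYr'; rewrite -{2}cr.
move=> b Yb Cb bc; have Fb := YF _ Yb; rewrite sym_refl_conj ?(root_norm1 Fr)//.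
have br : b <> r by move=> br; apply: nYr; rewrite -br.
apply: simple_refl_pos => //; first by do 2! apply: root_refl => //.
  apply: c_simple; [by rewrite /= rK|exact: simple_refl_pos|].
  by move=> bc'; apply: bc; rewrite -bc' rK.
move=> e; have := Yrefl _ _ Yc Yb.
by rewrite sym_refl_conj ?(root_norm1 Fr)// e.
Qed.

(** The positive roots of [Y] are conic combinations of its simple roots, and are in
    the orbits of these. The depth of a root that is not in [Pi] decreases under some
    [s_r] with [r] in [Pi]: if [r] is in [Y], then it is simple in [Y]; if not, the
    claim is carried from [s_r Y] to [Y]. *)
Lemma subsystem_generated b : F b -> C b -> forall Y, subsystem Y -> Y b ->
  conic_span (subsystem_simple Y) b /\
  exists2 s, word (subsystem_simple Y) s &
  exists2 a, subsystem_simple Y a & b = act B s a.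
Proof.
move=> Fb Cb; move: b Fb Cb; apply: depth_ind => b Fb Cb IH Y hY Yb.
have [Pb|nPb] := pselect (P b).
  have bY : subsystem_simple Y b.
    apply: (@simple_sub_subsystem Y [set b]) => //; [by move=> _ ->..].
  by split; [exact: conic_span_mem|exists [::] => //; exists b].
have [r Pr br0] := conic_form_gt0 Cb (root_norm1 Fb).
have br : b <> r by move=> br; apply: nPb; rewrite br.
have Fr := simple_root Pr; have rK := sym_reflK (root_norm1 Fr).
have [YF Yrefl] := hY.
have [Yr|nYr] := pselect (Y r).
  have [Csrb [s sY [a Ya sE]]] := IH r Pr br br0 Y hY (Yrefl _ _ Yr Yb).
  have rY : subsystem_simple Y r.
    by apply: (@simple_sub_subsystem Y [set r]) => // _ ->.
  split; last first.
    exists (r :: s); first by apply/word_cons.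
    by exists a => //; rewrite act_cons -sE rK.
  rewrite -[b](subrK ((2 * B b r) *: r)) -sym_reflE ?(root_norm1 Fr)//.
  apply: conic_spanD => //; apply: conic_spanZ; last exact: conic_span_mem.
  by rewrite mulr_ge0// ltW.
have hrY := subsystem_conj hY Fr.
have [|Csrb [s sY [a Ya sE]]] := IH r Pr br br0 _ hrY; first by rewrite /= rK.
split; last first.
  exists (map (sym_refl B r) s).
    by move=> _ /mapP[c /sY cY ->]; exact: subsystem_simple_conj.
  exists (sym_refl B r a); first exact: subsystem_simple_conj.
  have rF : word F [:: r] by move=> x; rewrite inE => /eqP->.
  have := act_map (@root_unit _ _ _ rs) s a rF; rewrite /= => <-.
  by rewrite -sE rK.
rewrite -[b]rK; elim/conic_span_ind: Csrb => [|c x v c0 xY _ IHv].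
  by rewrite sym_refl0; exact: conic_span0.
rewrite sym_reflP; apply: conic_spanD IHv; apply: conic_spanZ => //.
by apply: conic_span_mem; exact: subsystem_simple_conj.
Qed.

Section SubBasedRootSystem.
Variables (Y : set V) (hY : subsystem Y).
Notation PY := (subsystem_simple Y).

Lemma subsystem_simple_cone : conic_span PY `<=` C.
Proof. by apply: conic_span_sub => a []. Qed.

Lemma subsystem_sign b : Y b ->
  Y b /\ conic_span PY b \/ Y (- b) /\ conic_span PY (- b).
Proof.
move=> Yb; have Fb := hY.1 _ Yb; have Ynb := subsystem_opp hY Yb.
have [Cb|Cb] := root_sign Fb; [left|right]; split=> //.
  by have [] := subsystem_generated Fb Cb hY Yb.
by have [] := subsystem_generated (root_opp Fb) Cb hY Ynb.
Qed.

Lemma subsystem_word b : Y b ->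
  exists2 s, word PY s & exists2 a, PY a & b = act B s a.
Proof.
move=> Yb; have Fb := hY.1 _ Yb; have Ynb := subsystem_opp hY Yb.
have [Cb|Cb] := root_sign Fb; first by have [] := subsystem_generated Fb Cb hY Yb.
have [_ [s sY [a Ya bE]]] := subsystem_generated (root_opp Fb) Cb hY Ynb.
exists (rcons s a); first by rewrite -cats1; apply/word_cat; split=> // x; rewrite inE => /eqP->.
exists a => //; rewrite act_rcons sym_refl_self ?actN -?bE ?opprK//.
by apply: root_norm1; apply: hY.1; exact: subsystem_simple_sub.
Qed.

Lemma subsystem_simple_unit : unit_set B PY.
Proof. by move=> a /subsystem_simple_sub/hY.1/root_norm1. Qed.

Lemma subsystem_pointed :
  conic_span PY `&` conic_span [set - a | a in PY] = [set 0].
Proof.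
apply/seteqP; split=> [v [/subsystem_simple_cone Cv /conic_spanN]|_ ->].
  by move=> /subsystem_simple_cone/(cone_pointed Cv).
by split; exact: conic_span0.
Qed.

Lemma subsystem_simple_notin_cone a : PY a -> ~ conic_span (PY `\ a) a.
Proof.
move=> [Ya Ca a_simple] /= aPY; have Fa := hY.1 _ Ya.
apply: (root_npos Fa Ca); rewrite -(sym_refl_self (root_norm1 Fa)).
elim/conic_span_ind: {2}a / aPY => [|c x v c0 [[Yx Cx _] xa] _ IH].
  by rewrite sym_refl0; exact: conic_span0.
by rewrite sym_reflP; apply: conic_spanD IH; apply: conic_spanZ => //; exact: a_simple.
Qed.

Lemma subsystem_rootsE : Y = [set w a | w in refl_group B PY & a in PY].
Proof.
apply/seteqP; split=> [b /subsystem_word[s sY [a aY ->]]|_ [w + [a /subsystem_simple_sub Ya <-]]].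
  by exists (act B s); [exact: refl_group_act|exists a].
rewrite refl_groupE; last exact: subsystem_simple_unit.
move=> [s + <-]; elim: s => //= c s IH /word_cons[/subsystem_simple_sub Yc /IH].
exact: hY.2.
Qed.

Lemma subsystem_pos_neg :
  Y = (Y `&` conic_span PY) `|` (Y `&` conic_span [set - a | a in PY]).
Proof.
apply/seteqP; split=> [b Yb|b [[]|[]]//].
have [[_ ?]|[_ ?]] := subsystem_sign Yb; first by left.
by right; split=> //; apply/conic_spanN.
Qed.

(** The based root system [(Y, Pi_Y)]. *)
Definition sub_brs : basedRootSystem B :=
  BasedRootSystem subsystem_pointed subsystem_simple_notin_cone
    subsystem_simple_unit subsystem_rootsE subsystem_pos_neg.

Lemma subsystem_refl_group : refl_group B Y = refl_group B PY.
Proof.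
apply/seteqP; split; last by apply: refl_groupS; exact: subsystem_simple_sub.
apply: refl_group_min; first exact/refl_group_transf/subsystem_simple_unit.
move=> _ /subsystem_word[s sY [a aY ->]].
rewrite (sym_refl_act subsystem_simple_unit)//.
apply: refl_group_act; apply/word_cat; split=> //.
by apply/word_cons; split=> //; exact: word_rev.
Qed.

End SubBasedRootSystem.

Lemma roots_of_subsystem U : transf_group U -> subsystem (roots_of rs U).
Proof.
move=> [U1 UM _]; split=> [b []//|a b [Fa Ua] [Fb Ub]]; split; first exact: root_refl.
have -> : sym_refl B (sym_refl B a b) = sym_refl B a \o (sym_refl B b \o sym_refl B a).
  by apply/funext => v; rewrite sym_refl_conj// (root_norm1 Fa).
by apply: (UM) => //; exact: UM.
Qed.

Lemma refl_group_reflection_subgroup X : X `<=` F ->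
  reflection_subgroup rs (refl_group B X).
Proof.
move=> XF; have X1 : unit_set B X by move=> x /XF/root_norm1.
split; first exact: refl_group_transf.
  apply: refl_group_min => [|a /XF]; last exact: root_refl_cox.
  by apply: refl_group_transf; exact: simple_unit.
apply/seteqP; split.
  apply: refl_group_min => [|a Xa].
    suff -> : refl_group B X `&` reflections rs
        = [set sym_refl B a | a in roots_of rs (refl_group B X)].
      by apply: refl_group_transf => x [/root_norm1].
    apply/seteqP; split=> [t [Xt [a Fa aE]]|_ [a [Fa ?] <-]].
      by exists a => //; split=> //; rewrite aE.
    by split=> //; exists a.
  by apply: gen_group_sub; split; [exact: refl_group_mem|exists a => //; exact: XF].
by apply: gen_group_min => [|w []//]; exact: refl_group_transf.
Qed.

Lemma reflection_subgroupE U : reflection_subgroup rs U ->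
  U = refl_group B (roots_of rs U).
Proof.
move=> [gU _ {1}->]; congr gen_group; apply/seteqP; split.
  by move=> t [Ut [a Fa aE]]; exists a => //; split=> //; rewrite aE.
by move=> _ [a [Fa Ua] <-]; split=> //; exists a.
Qed.

Lemma reflection_subgroup_simple U : reflection_subgroup rs U ->
  U = refl_group B (subsystem_simple (roots_of rs U)).
Proof.
move=> hU; rewrite -subsystem_refl_group -?reflection_subgroupE//.
by apply: roots_of_subsystem; case: hU.
Qed.

(** ** Comparison with the canonical generators *)

Lemma simple_wordP w n :
  simple_word rs w n <-> exists s, [/\ word P s, size s = n & w = act B s].
Proof.
split=> [[f [fP ->]]|[s [sP <- ->]]].
  elim: n f fP => [|n IH] f fP; first by exists [::]; split=> //; rewrite big_ord0.
  have [s [sP sn sE]] := IH _ (fun i => fP (lift ord0 i)).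
  have [a Pa aE] := fP ord0.
  exists (a :: s); split; [by apply/word_cons|by rewrite /= sn|].
  by rewrite big_ord_recl sE -aE.
elim: s sP => [|a s IH] sP; first by exists (fun=> id); split=> [[]//|]; rewrite big_ord0.
move/word_cons: sP => [Pa /IH[f [fP fE]]].
exists (fun i => oapp f (sym_refl B a) (unlift ord0 i)); split.
  by move=> i; case: unliftP => [j _|_] /=; [exact: fP|exists a].
rewrite big_ord_recl unlift_none; congr (_ \o _); rewrite -[LHS]/(act B s) fE.
by apply: eq_bigr => i _; rewrite liftK.
Qed.

Lemma cox_lengthP w : coxeter_group rs w ->
  (exists s, [/\ word P s, size s = cox_length rs w & w = act B s]) /\
  (forall s, word P s -> w = act B s -> (cox_length rs w <= size s)%N).
Proof.
rewrite /coxeter_group refl_groupE; last exact: simple_unit.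
move=> [s0 /= s0P s0E].
have [|n + n_min] := @ex_minnP (fun n => `[< simple_word rs w n >]).
  by exists (size s0); apply/asboolP/simple_wordP; exists s0.
move=> /asboolP wn.
rewrite /cox_length; case: xgetP => [m _ [wm m_min]|/(_ n)[]]; last first.
  by split=> // m /asboolP/n_min.
split; first exact/simple_wordP.
by move=> s sP sE; apply: m_min; apply/simple_wordP; exists s.
Qed.

(** The simple roots of [Phi_U] give canonical generators of [U]: by the exchange
    condition, if [b] is positive and [l (s_b s_a) < l s_a], then [s_a b] is
    negative. *)
Lemma subsystem_simple_canonical U : transf_group U ->
  subsystem_simple (roots_of rs U) `<=` simple_roots_of rs U.
Proof.
move=> gU a [[Fa Ua] Ca a_simple]; split; first by split.
have coxM w w' : coxeter_group rs w -> coxeter_group rs w' -> coxeter_group rs (w \o w').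
  by have [_ + _] := refl_group_transf (@simple_unit _ _ _ rs); apply.
have saK := sym_reflK (root_norm1 Fa).
split; first by exists a.
apply/seteqP; split=> [t [[[b0 Fb0 b0E] tlen] Ut]|_ ->].
  have [b [Fb Cb bE]] : exists b, [/\ F b, C b & sym_refl B b = t].
    have [Cb|Cb] := root_sign Fb0; first by exists b0.
    by exists (- b0); split=> //; [exact: root_opp|rewrite sym_refl_opp].
  have [ba|ba] := pselect (b = a); first by rewrite /= -bE ba.
  have Csab : C (sym_refl B a b) by apply: a_simple => //; split=> //; rewrite bE.
  have := root_refl_cox Fa; have := root_refl_cox Fb; rewrite bE => ct ca.
  have [[s [sP sn sE]] _] := cox_lengthP (coxM _ _ ct ca).
  have [|u [uP us uE]] := strong_exchange sP Fb Cb.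
    have -> : act B (rev s) b = - sym_refl B a b.
      apply: (can_inj (actK (@simple_unit _ _ _ rs) sP)).
      rewrite (actKV (@simple_unit _ _ _ rs) sP) -sE /= -bE sym_reflN saK.
      by rewrite sym_reflN sym_refl_self ?opprK// (root_norm1 Fb).
    by rewrite opprK.
  have saE : sym_refl B a = act B u.
    by apply/funext => v; rewrite uE -sE -bE /= (sym_reflK (root_norm1 Fb)).
  have [_ /(_ u uP saE) lu] := cox_lengthP ca.
  by move: (leq_ltn_trans lu us); rewrite sn ltnNge (ltnW tlen).
split=> //; split; first by exists a.
have -> : sym_refl B a \o sym_refl B a = act B [::] by apply/funext => v /=; rewrite saK.
have [|_ /(_ [::])] := @cox_lengthP (act B [::]); first exact: refl_group_act.
move=> /(_ (@word_nil _ _) erefl); rewrite leqn0 => /eqP->.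
have [[s [_ <- sE]] _] := cox_lengthP (root_refl_cox Fa).
case: s sE => // aE; have := congr1 (fun f => f a) aE.
rewrite (sym_refl_self (root_norm1 Fa)) /= => naE.
by case: (root_npos Fa Ca); rewrite naE.
Qed.

End Subsystems.

(** * Linear independence modulo a subspace *)

Section IndepMod.
Context (R : realType) (E : lmodType R).
Implicit Types (X Y Z : set E).

(** The family [y] is linearly independent modulo the span of [Z]. *)
Definition indep_mod Z n (y : 'I_n -> E) : Prop :=
  forall c : 'I_n -> R, lin_span Z (\sum_i c i *: y i) -> forall i, c i = 0.

Lemma lin_span_setU_range Z n (x : 'I_n -> E) v : lin_span (Z `|` range x) v ->
  exists c : 'I_n -> R, lin_span Z (v - \sum_i c i *: x i).
Proof.
elim/lin_span_ind=> [|d w v' Hw _ [c IH]].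
  exists (fun=> 0); rewrite big1 ?subr0; first exact: lin_span0.
  by move=> i _; rewrite scale0r.
case: Hw => [Zw|[j _ <-]].
  by exists c; rewrite -addrA; apply: lin_spanD => //; exact/lin_spanZ/lin_span_mem.
exists (fun i => (if i == j then d else 0) + c i).
under eq_bigr do rewrite scalerDl.
rewrite big_split/= (bigD1 j)//= eqxx big1 ?addr0; last first.
  by move=> i /negPf->; rewrite scale0r.
by rewrite opprD addrACA subrr add0r.
Qed.

(** Steinitz exchange modulo a subspace. *)
Lemma indep_mod_exchange Z n k (x : 'I_n -> E) (y : 'I_k -> E) :
  indep_mod Z y -> (forall i, lin_span (Z `|` range x) (y i)) ->
  (k <= n)%N /\ ((n <= k)%N -> forall j, lin_span (Z `|` range y) (x j)).
Proof.
move=> yi yx; have [a aE] := choice (fun i => lin_span_setU_range (yx i)).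
pose A := \matrix_(i, j) a i j.
have Afree : row_free A.
  apply: inj_row_free => u uA0; apply/rowP => i; rewrite mxE; apply: yi i.
  have -> : \sum_i u 0 i *: y i = \sum_i u 0 i *: (y i - \sum_j a i j *: x j).
    rewrite [RHS](eq_bigr (fun i => u 0 i *: y i - \sum_j (u 0 i * a i j) *: x j)).
      rewrite big_split/= sumrN exchange_big/= [X in _ - X]big1 ?subr0// => j _.
      rewrite -scaler_suml -[RHS](scale0r (x j)); congr (_ *: _).
      transitivity ((u *m A) 0 j); last by rewrite uA0 mxE.
      by rewrite mxE; apply: eq_bigr => i _; rewrite mxE.
    move=> i _; rewrite scalerBr scaler_sumr; congr (_ - _).
    by apply: eq_bigr => j _; rewrite scalerA.
  by apply: lin_span_sum => i _; apply/lin_spanZ/aE.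
have kn : (k <= n)%N by rewrite -(eqP Afree) rank_leq_col.
split=> // nk j; have {nk kn} nk : n = k by apply/eqP; rewrite eqn_leq nk.
subst n.
have Au : A \in unitmx by rewrite -row_free_unit.
have -> : x j = \sum_i invmx A j i *: (y i - (y i - \sum_l a i l *: x l)).
  transitivity (\sum_l (invmx A *m A) j l *: x l).
    rewrite mulVmx// (bigD1 j)//= mxE eqxx scale1r big1 ?addr0// => l lj.
    by rewrite mxE eq_sym (negPf lj) scale0r.
  under eq_bigr do rewrite mxE scaler_suml.
  rewrite exchange_big/=; apply: eq_bigr => i _.
  rewrite opprB addrCA subrr addr0 scaler_sumr; apply: eq_bigr => l _.
  by rewrite mxE scalerA.
apply: lin_span_sum => i _; apply/lin_spanZ/lin_spanB.
  by apply: lin_span_mem; right; exists i.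
by apply: lin_span_sub (aE i) => z Zz; apply: lin_span_mem; left.
Qed.

Lemma lin_indep_indep_mod X Z s : lin_indep X -> Z `<=` X -> uniq s ->
  word (X `\` Z) s -> indep_mod Z (fun i : 'I_(size s) => s`_i).
Proof.
move=> Xi ZX us sX c /lin_spanP[l lZ]; rewrite sum_regroup.
set t := undup _; set d := fun z => \sum_(p <- l | p.2 == z) p.1 => cE.
have tZ : word Z t by move=> z; rewrite mem_undup => /mapP[p /lZ ? ->].
pose c' z := if z \in s then oapp c 0 (insub (index z s)) else - d z.
have c'E (i : 'I_(size s)) : c' s`_i = c i.
  by rewrite /c' mem_nth// index_uniq//= valK.
have st z : z \in t -> z \notin s by move=> /tZ Zz; apply/negP => /sX[].
move=> i; rewrite -c'E; apply: (Xi (s ++ t)); last by rewrite mem_cat mem_nth.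
- rewrite cat_uniq us undup_uniq andbT; apply/hasPn => z; exact: st.
- by move=> z; rewrite mem_cat => /orP[/sX[]//|/tZ/ZX].
have -> : \sum_(x <- s ++ t) c' x *: x
    = \sum_(j < size s) c j *: s`_j + \sum_(x <- t) c' x *: x.
  rewrite big_cat/=; congr (_ + _); rewrite (big_nth 0) big_mkord.
  by apply: eq_bigr => j _; rewrite c'E.
rewrite cE -big_split big_seq big1//= => z zt.
by rewrite /c' (negPf (st _ zt)) scaleNr subrr.
Qed.

Lemma indep_mod_dual Z n (y : 'I_n -> E) (phi : 'I_n -> E -> R) :
  (forall i c u v, phi i (c *: u + v) = c * phi i u + phi i v) ->
  (forall i z, Z z -> phi i z = 0) -> (forall i j, phi i (y j) = (i == j)%:R) ->
  indep_mod Z y.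
Proof.
move=> phiP phiZ phiy c cZ i.
have phi00 : phi i 0 = 0.
  by apply: (addrI (phi i 0)); rewrite -{1}[phi i 0]mul1r -phiP scale1r !addr0.
have phi0 v : lin_span Z v -> phi i v = 0.
  elim/lin_span_ind=> [//|d w v' Zw _ IH].
  by rewrite phiP IH phiZ// mulr0 addr0.
have phi_sum r : phi i (\sum_(j <- r) c j *: y j) = \sum_(j <- r) c j * (i == j)%:R.
  by elim: r => [|j r IH]; rewrite ?big_nil// !big_cons phiP IH phiy.
move: (phi0 _ cZ); rewrite phi_sum (bigD1 i)//= eqxx mulr1.
by rewrite big1 ?addr0// => j ji; rewrite eq_sym (negPf ji) mulr0.
Qed.

End IndepMod.

(** Either [A] has [n] distinct elements or fewer than [n] elements list it. *)
Lemma uniq_or_enum (T : choiceType) (A : set T) n :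
  (exists s, [/\ uniq s, size s = n & word A s]) \/
  (exists s, (size s < n)%N /\ A = [set` s]).
Proof.
elim: n => [|n [[s [us sn sA]]|[s [sn AE]]]]; first by left; exists [::].
  have [[x Ax xs]|h] := pselect (exists2 x, A x & x \notin s).
    left; exists (x :: s); split; rewrite /= ?xs ?sn//.
    by apply/word_cons.
  right; exists s; rewrite sn; split=> //; apply/seteqP; split=> [x Ax|x /sA//].
  by apply: contrapT => /negP xs; apply: h; exists x.
by right; exists s; rewrite ltnS ltnW.
Qed.

(** * The lift in which the simple roots become linearly independent *)

Section Coordinates.
Context (R : realType) (V : lmodType R).
Implicit Types (a b r : V) (X K : set V).

(** The vector [a] together with its indicator function: a lift [(v, f)] of a
    root [v] records in [f] its coordinates along the simple roots. *)
Definition coord_vec a : V * (V -> R^o) := (a, fun b => (b == a)%:R).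

Implicit Types (x y : V * (V -> R^o)).

Lemma coord_vecE a b : (coord_vec a).2 b = (b == a)%:R.
Proof. by []. Qed.

Lemma coordP c x y r : (c *: x + y).2 r = c * x.2 r + y.2 r.
Proof. by []. Qed.

Lemma coord_ge0 X x r : conic_span (coord_vec @` X) x -> 0 <= x.2 r.
Proof.
elim/conic_span_ind=> [|c _ y c0 [a Xa <-] _ y0]; first exact: lexx.
by rewrite coordP addr_ge0// mulr_ge0// coord_vecE ler0n.
Qed.

(** A vector in the span of the lift of [K] has no coordinate outside [K]. *)
Lemma coord_out K x r : lin_span (coord_vec @` K) x -> ~ K r -> x.2 r = 0.
Proof.
move=> + nKr; elim/lin_span_ind=> // c _ y [a Ka <-] _ y0.
rewrite coordP y0 coord_vecE (_ : _ == _ = false) ?mulr0 ?addr0//.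
by apply/eqP => ra; apply: nKr; rewrite ra.
Qed.

Lemma conic_coord_eq0 X x : conic_span (coord_vec @` X) x ->
  (forall r, X r -> x.2 r = 0) -> x = 0.
Proof.
elim/conic_span_ind=> // c _ y c0 [a Xa <-] yX IH h.
have /eqP := h a Xa; rewrite coordP coord_vecE eqxx mulr1.
rewrite paddr_eq0// ?(coord_ge0 _ yX)// => /andP[/eqP c00 _].
move: h; rewrite c00 scale0r add0r; exact: IH.
Qed.

Lemma conic_span_part (E : lmodType R) (X Y : set E) v : conic_span X v ->
  exists w w', [/\ conic_span Y w, conic_span (X `\` Y) w' & v = w + w'].
Proof.
elim/conic_span_ind=> [|c x u c0 Xx _ [w [w' [wY w'X ->]]]].
  by exists 0, 0; rewrite addr0; split=> //; exact: conic_span0.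
have [Yx|nYx] := pselect (Y x).
  exists (c *: x + w), w'; rewrite addrA; split=> //; apply: conic_spanD => //.
  by apply: conic_spanZ => //; exact: conic_span_mem.
exists w, (c *: x + w'); rewrite addrCA; split=> //; apply: conic_spanD => //.
by apply: conic_spanZ => //; exact: conic_span_mem.
Qed.

(** A conic combination of the lift of [X] that is in the span of the lift of [K] is
    a conic combination of the lift of [K]. *)
Lemma conic_lin_coord X K x : conic_span (coord_vec @` X) x ->
  lin_span (coord_vec @` K) x -> conic_span (coord_vec @` K) x.
Proof.
move=> /(conic_span_part (coord_vec @` K))[w [w' [wK w'X ->]]] xK.
suff -> : w' = 0 by rewrite addr0.
have w'K : lin_span (coord_vec @` K) w'.
  by rewrite -[w'](addKr w) addrC; apply: lin_spanB => //; exact: conic_span_lin.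
apply: (@conic_coord_eq0 (X `\` K)) => [|r [_ nKr]]; last exact: coord_out w'K nKr.
apply: conic_span_sub w'X => _ [[a Xa <-] nKa]; apply: conic_span_mem.
by exists a => //; split=> // Ka; apply: nKa; exists a.
Qed.

End Coordinates.

Section CoordinateLift.
Context (R : realType) (V : lmodType R) (B : {symmetric V}).
Context (rs : basedRootSystem B).
Implicit Types (a b r : V) (J K : set V).
Notation P := (simple_roots rs).
Notation F := (root_set rs).
Notation C := (conic_span P).
Notation e := (@coord_vec R V).

(** The lift of the roots to [V * R^V], in which [Pi] becomes linearly independent. *)
Definition coord_lift : V -> V * (V -> R^o) := lift_root rs fst e.

Let fst_e a : P a -> fst (e a) = a. Proof. by []. Qed.

Lemma coord_lift_simple a : P a -> coord_lift a = e a.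
Proof. exact: lift_simple. Qed.

Lemma coord_lift_fst b : F b -> (coord_lift b).1 = b.
Proof. exact: pi_lift. Qed.

Lemma coord_lift_refl a b : F a -> F b ->
  coord_lift (sym_refl B a b) = coord_lift b - (2 * B b a) *: coord_lift a.
Proof. exact: lift_sym_refl. Qed.

Lemma coord_lift_image X : X `<=` P -> coord_lift @` X = e @` X.
Proof.
move=> XP; apply/seteqP; split=> _ [a Xa <-]; exists a => //;
  by rewrite coord_lift_simple//; exact: XP.
Qed.

(** Simple roots outside [J] have lifts that are independent modulo those of [J]. *)
Lemma coord_lift_indep J s : J `<=` P -> uniq s -> word (P `\` J) s ->
  indep_mod (coord_lift @` J) (fun i : 'I_(size s) => coord_lift s`_i).
Proof.
move=> JP us sP; rewrite coord_lift_image//.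
apply: (@indep_mod_dual R (V * (V -> R^o))%type _ _ _
  (fun (i : 'I_(size s)) (x : V * (V -> R^o)) => x.2 s`_i)) => //.
  move=> i _ [a Ja <-]; rewrite coord_vecE; case: eqP => // ia.
  by have [_ []] := sP _ (mem_nth 0 (ltn_ord i)); rewrite ia.
move=> i j; rewrite coord_lift_simple; last by have [] := sP _ (mem_nth 0 (ltn_ord j)).
by rewrite coord_vecE nth_uniq.
Qed.

Section Parabolic.
Variables (K : set V) (KP : K `<=` P).

Lemma parabolic_lift b : F b -> refl_group B K (sym_refl B b) ->
  lin_span (e @` K) (coord_lift b).
Proof.
move=> Fb Kb; rewrite -coord_lift_image//.
by apply: lift_span => // a /KP/simple_root.
Qed.

Lemma parabolic_cone b : F b -> C b -> lin_span (e @` K) (coord_lift b) ->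
  conic_span K b.
Proof.
move=> Fb Cb bK; have := conic_lin_coord (lift_pos fst_e Fb Cb) bK.
move=> /(conic_span_image fst); rewrite /= coord_lift_fst//.
by apply: conic_span_sub => _ [_ [a Ka <-] <-]; exact: conic_span_mem.
Qed.

(** The roots of a standard parabolic subgroup are those whose lift is in the
    span of the corresponding simple roots. *)
Lemma parabolic_root b : F b -> lin_span (e @` K) (coord_lift b) ->
  refl_group B K (sym_refl B b).
Proof.
have K1 : unit_set B K by move=> a /KP/(@simple_unit _ _ _ rs).
have [_ KM _] := refl_group_transf K1.
have pos b' : F b' -> C b' -> lin_span (e @` K) (coord_lift b') ->
    refl_group B K (sym_refl B b').
  move: b'; apply: depth_ind => {}b Fb Cb IH bK.
  have [r Kr br0] := conic_form_gt0 (parabolic_cone Fb Cb bK) (root_norm1 Fb).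
  have [br|br] := pselect (b = r); first by rewrite br; exact: refl_group_mem.
  have Pr := KP Kr; have Fr := simple_root Pr.
  have : refl_group B K (sym_refl B (sym_refl B r b)).
    apply: IH => //; rewrite coord_lift_refl//; apply: lin_spanB => //.
    by apply/lin_spanZ/lin_span_mem; exists r => //; rewrite coord_lift_simple.
  have rK : refl_group B K (sym_refl B r) by exact: refl_group_mem.
  move=> /(KM _ _ rK) /KM/(_ rK); congr (refl_group B K _); apply/funext => v /=.
  by rewrite sym_refl_conj ?(root_norm1 Fr)// !(sym_reflK (root_norm1 Fr)).
move=> Fb; have [Cb|Cb] := root_sign Fb; first exact: pos.
move=> bK; rewrite -sym_refl_opp; apply: pos => //; first exact: root_opp.
rewrite -(sym_refl_self (root_norm1 Fb)) coord_lift_refl//.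
by apply: lin_spanB => //; exact: lin_spanZ.
Qed.

End Parabolic.

End CoordinateLift.

(** * Corank *)

(** A set of at most [n] values of [f] on [Y] is the image of a list of length at
    most [n]. *)
Lemma card_le_image_seq (T : Type) (A : eqType) (f : A -> T) (X : set T)
    (Y : set A) n : (X #<= `I_n)%card -> X `<=` f @` Y ->
  exists s, [/\ (size s <= n)%N, word Y s & X = f @` [set` s]].
Proof.
move=> /pfcard_geP[->|[g]] XY; first by exists [::]; split; rewrite // set_nil image_set0.
have [[a0 Ya0]|Y0] := pselect (exists a, Y a); last first.
  exists [::]; split=> //; rewrite set_nil image_set0.
  by apply/seteqP; split=> // t /XY[a Ya _]; apply: Y0; exists a.
have h i : exists a, (i < n)%N -> Y a /\ f a = g i.
  have [i_n|_] := boolP (i < n)%N; last by exists a0.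
  have [a Ya aE] := XY (g i) (funS i i_n).
  by exists a.
have [a aE] := choice h; exists (mkseq a n); split; first by rewrite size_mkseq.
  by move=> x /mapP[i]; rewrite mem_iota => /aE[? _] ->.
apply/seteqP; split=> [t /(@surj _ _ _ _ g)[i i_n <-]|_ [x /mapP[i + ->] <-]].
  exists (a i); last by case: (aE i i_n).
  by apply/mapP; exists i => //; rewrite mem_iota.
by rewrite mem_iota => i_n; case: (aE i i_n) => _ ->; exact: funS.
Qed.

Lemma card_image_seq (T : Type) (A : choiceType) (f : A -> T) (s : seq A) :
  (f @` [set` s] #<= `I_(size s))%card.
Proof.
apply: card_le_trans (card_image_le _ _) _.
case: s => [|a s]; first by rewrite set_nil; exact: card_ge0.
apply: card_le_trans (card_image_le (nth a (a :: s)) _).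
apply: subset_card_le => x /= xs; exists (index x (a :: s)); last by rewrite nth_index.
by rewrite -index_mem in xs.
Qed.

Section Corank.
Context (R : realType) (V : lmodType R) (B : {symmetric V}).
Context (rs : basedRootSystem B) (J : set V) (JP : J `<=` simple_roots rs).
Implicit Types (a b x : V) (s : seq V) (U : set (V -> V)) (n k : nat).
Notation P := (simple_roots rs).
Notation F := (root_set rs).
Notation C := (conic_span P).
Notation WJ := (refl_group B J).

(** [U] is generated by [W_J] and at most [n] reflections. *)
Definition generated_by U n :=
  exists s, [/\ (size s <= n)%N, word F s & U = refl_group B (J `|` [set` s])].

Lemma simple_subset_root : J `<=` F.
Proof. by move=> a /JP/simple_root. Qed.

Lemma generators_sub_root s : word F s -> J `|` [set` s] `<=` F.
Proof. by move=> sF a [/simple_subset_root|/sF]. Qed.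

Lemma generators_unit s : word F s -> unit_set B (J `|` [set` s]).
Proof. by move=> sF a /(generators_sub_root sF)/root_norm1. Qed.

Lemma corank_gens_generated U T n : transf_group U -> WJ `<=` U ->
  corank_gens rs U WJ T -> (T #<= `I_n)%card -> generated_by U n.
Proof.
move=> gU JU [TU UE] /card_le_image_seq/(_ (fun t Tt => (TU t Tt).2))[s [sn sF TE]].
exists s; split=> //; rewrite TE in UE TU; apply/seteqP; split.
  rewrite [X in X `<=` _]UE; apply: gen_group_min.
    exact/refl_group_transf/generators_unit.
  move=> t [[+ _]|[a sa <-]]; last by apply: refl_group_mem; right.
  by apply: refl_groupS => a; left.
apply: refl_group_min => // a [Ja|sa]; first by apply: JU; apply: refl_group_mem.
by have [] // := TU (sym_refl B a); exists a.
Qed.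

Lemma generated_corank_gens U n : generated_by U n ->
  exists2 T, corank_gens rs U WJ T & (T #<= `I_n)%card.
Proof.
move=> [s [sn sF UE]]; exists (sym_refl B @` [set` s]); last first.
  by apply: card_le_trans (card_image_seq _ _) _; rewrite card_le_II.
have gU : transf_group U by rewrite UE; exact/refl_group_transf/generators_unit.
have JU : WJ `<=` U by rewrite UE; apply: refl_groupS => a; left.
have sU a : a \in s -> U (sym_refl B a) by move=> sa; rewrite UE; apply: refl_group_mem; right.
split; first by move=> _ [a sa <-]; split; [exact: sU|exists a => //; exact: sF].
apply/seteqP; split; last first.
  by apply: gen_group_min => // t [[/JU]|[a /sU ? <-]].
rewrite UE => t tU G [gG XG]; apply: tU; split=> // _ [a [Ja|sa] <-]; apply: XG.
  by left; split; [exact: refl_group_mem|exists a => //; exact: simple_subset_root].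
by right; exists a.
Qed.

(** The corank is [k] if and only if [k] is the least number of reflections that,
    together with [W_J], generate [U]. *)
Lemma has_corankP U k : reflection_overgroup rs J U ->
  has_corank rs U WJ k <->
  generated_by U k /\ (forall n, generated_by U n -> (k <= n)%N).
Proof.
move=> [[gU _ _] JU]; split=> [[[T TU Tk] Tmin]|[Uk kmin]].
  split; first by apply: corank_gens_generated TU _ => //; move: Tk; rewrite card_eq_le => /andP[].
  move=> n /generated_corank_gens[T' /Tmin kT' T'n].
  by rewrite -card_le_II; exact: card_le_trans T'n.
have T_card T : corank_gens rs U WJ T -> (`I_k #<= T)%card.
  move=> TU; have [/finite_setP[m Tm]|/infiniteP T_inf] := pselect (finite_set T).
    apply: (@card_le_trans _ _ _ `I_m); last by move/card_esym: Tm; rewrite card_eq_le => /andP[].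
    rewrite card_le_II; apply: kmin; apply: corank_gens_generated TU _ => //.
    by move: Tm; rewrite card_eq_le => /andP[].
  by apply: card_le_trans T_inf; exact: subset_card_le.
split=> //; have [T TU Tk] := generated_corank_gens Uk.
by exists T => //; rewrite card_eq_le Tk T_card.
Qed.

Lemma generated_overgroup U n : generated_by U n -> reflection_overgroup rs J U.
Proof.
move=> [s [_ sF ->]]; split; last by apply: refl_groupS => a; left.
exact/refl_group_reflection_subgroup/generators_sub_root.
Qed.

Lemma corank_overgroupP U k : corank_overgroup rs J k U <->
  generated_by U k /\ (forall n, generated_by U n -> (k <= n)%N).
Proof.
split=> [[hU /(has_corankP _ hU)]//|h].
by have hU := generated_overgroup h.1; split=> //; apply/has_corankP.
Qed.

Lemma overgroup_roots U : reflection_overgroup rs J U -> J `<=` roots_of rs U.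
Proof.
move=> [_ JU] a Ja; split; first exact: simple_subset_root.
by apply: JU; apply: refl_group_mem.
Qed.

Lemma reflection_subgroup_le U U' : reflection_subgroup rs U ->
  reflection_subgroup rs U' -> roots_of rs U `<=` roots_of rs U' -> U `<=` U'.
Proof.
by move=> /reflection_subgroupE{2}-> /reflection_subgroupE{2}->; exact: refl_groupS.
Qed.

Lemma roots_ofS U U' : U `<=` U' -> roots_of rs U `<=` roots_of rs U'.
Proof. by move=> UU' a [Fa /UU']. Qed.

(** If [U] is generated by [W_J] and [n] reflections, then a lift of its roots
    spans a space of dimension at most [n] modulo the lift of [J]; a family of
    [n] independent elements is then a basis. *)
Lemma generated_span (E : lmodType R) (f : V -> E) (Y : set V) U n k (y : 'I_k -> V) :
  subsystem rs Y ->
  (forall a b, Y a -> Y b -> f (sym_refl B a b) = f b - (2 * B b a) *: f a) ->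
  roots_of rs U `<=` Y -> generated_by U n ->
  (forall i, roots_of rs U (y i)) -> indep_mod (f @` J) (f \o y) ->
  (k <= n)%N /\
  ((n <= k)%N -> forall b, roots_of rs U b -> lin_span (f @` J `|` range (f \o y)) (f b)).
Proof.
move=> [YF Yrefl] frefl UY [s [sn sF UE]] yU yi.
pose x (i : 'I_(size s)) := f s`_i.
have XU : J `|` [set` s] `<=` roots_of rs U.
  by move=> a Xa; split; [exact: generators_sub_root Xa|rewrite UE; exact: refl_group_mem].
have span b : roots_of rs U b -> lin_span (f @` J `|` range x) (f b).
  move=> Ub; have Y1 : unit_set B Y by move=> a /YF/root_norm1.
  have := refl_group_span Y1 Yrefl frefl (subset_trans XU UY) (UY _ Ub).
  rewrite -UE => /(_ Ub.2); apply: lin_span_sub => _ [a [Ja|sa] <-]; apply: lin_span_mem.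
    by left; exists a.
  have ia : (index a s < size s)%N by rewrite index_mem.
  by right; exists (Ordinal ia) => //; rewrite /x /= nth_index.
have [ks xspan] := indep_mod_exchange yi (fun i => span _ (yU i)).
split; first exact: leq_trans sn.
move=> nk b /span; apply: lin_span_sub => t [Jt|[j _ <-]]; first by apply: lin_span_mem; left.
by apply: xspan; exact: leq_trans nk.
Qed.

Lemma generated_rank U n k (y : 'I_k -> V) : reflection_subgroup rs U ->
  (forall i, roots_of rs U (y i)) -> indep_mod J y -> generated_by U n ->
  (k <= n)%N /\ ((n <= k)%N -> roots_of rs U `<=` lin_span (J `|` range y)).
Proof.
move=> [gU _ _] yU yi Un.
have [|||kn sp] := @generated_span V id (roots_of rs U) U n k y (roots_of_subsystem rs gU) _ _ Un yU.
- by move=> a b [Fa _] _; rewrite (sym_reflE _ (root_norm1 Fa)).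
- by [].
- by rewrite image_id.
by split=> // nk b /(sp nk); rewrite image_id.
Qed.

(** A generating set of roots containing [J] has at least [k] elements outside [J]
    when the corank is [k]. *)
Lemma corank_simple U X k : (forall n, generated_by U n -> (k <= n)%N) ->
  U = refl_group B X -> J `<=` X -> X `<=` F ->
  exists s, [/\ uniq s, size s = k & word (X `\` J) s].
Proof.
move=> kmin UX JX XF; have [//|[s [sk sE]]] := uniq_or_enum (X `\` J) k.
have : generated_by U (size s).
  exists s; split=> // [a sa|].
    by have [/XF] : (X `\` J) a by rewrite sE.
  by rewrite UX -sE setDUK.
by move=> /kmin; rewrite leqNgt sk.
Qed.

(** ** The maximum among the overgroups of the same corank *)

Section Maximum.
Variables (U : set (V -> V)) (k : nat) (y : 'I_k -> V).
Hypotheses (Uk : generated_by U k) (yU : forall i, roots_of rs U (y i)).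
Hypothesis (yi : indep_mod J y).

(** The subgroup generated by the corank [k] overgroups that contain [U]. *)
Definition overgroup_join : set (V -> V) :=
  refl_group B [set a | exists U', [/\ corank_overgroup rs J k U', U `<=` U'
                                     & roots_of rs U' a]].

Lemma rank_min U' n : U `<=` U' -> generated_by U' n -> (k <= n)%N.
Proof.
move=> UU' U'n; have [hU' _] := generated_overgroup U'n.
by have [] := generated_rank hU' (fun i => roots_ofS UU' (yU i)) yi U'n.
Qed.

Lemma corank_self : corank_overgroup rs J k U.
Proof. by apply/corank_overgroupP; split=> // n; exact: rank_min. Qed.

Lemma overgroup_join_reflection : reflection_subgroup rs overgroup_join.
Proof. by apply: refl_group_reflection_subgroup => a [U' [_ _ []]]. Qed.

Lemma overgroup_join_ub U' : corank_overgroup rs J k U' -> U `<=` U' ->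
  U' `<=` overgroup_join.
Proof.
move=> hU' UU'; have [[rU' _] _] := hU'.
rewrite [X in X `<=` _](reflection_subgroupE rU'); apply: refl_groupS => a aU'.
by exists U'.
Qed.

(** In the lift attached to the simple roots of the join, all the overgroups
    have roots in one space, of dimension [k] modulo [J]. *)
Lemma overgroup_join_corank : corank_overgroup rs J k overgroup_join.
Proof.
have [gM _ _] := overgroup_join_reflection.
have UM : U `<=` overgroup_join by apply: overgroup_join_ub => //; exact: corank_self.
have hY := roots_of_subsystem rs gM.
set Y := roots_of rs overgroup_join in hY *.
pose rs' := sub_brs hY; pose f := coord_lift rs'.
have JU := overgroup_roots (generated_overgroup Uk).
have JY : J `<=` subsystem_simple rs Y.
  by apply: simple_sub_subsystem => // a /JU; exact: roots_ofS.
have frefl a b : Y a -> Y b -> f (sym_refl B a b) = f b - (2 * B b a) *: f a.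
  exact: (@coord_lift_refl _ _ _ rs').
have f1 b : Y b -> (f b).1 = b by exact: (@coord_lift_fst _ _ _ rs').
have yY i : Y (y i) by exact: roots_ofS (yU i).
have fyi : indep_mod (f @` J) (f \o y).
  move=> c /(lin_span_image fst) h; apply: yi.
  have <- : fst (\sum_i c i *: (f \o y) i) = \sum_i c i *: y i.
    rewrite linear_sum; apply: eq_bigr => i _.
    by rewrite linearZ_LR /= f1.
  move: h; apply: lin_span_sub => _ [_ [a Ja <-] <-]; apply: lin_span_mem.
  by rewrite /= f1//; apply: subsystem_simple_sub; apply: JY.
have span U' b : corank_overgroup rs J k U' -> U `<=` U' -> roots_of rs U' b ->
    lin_span (f @` J `|` range (f \o y)) (f b).
  move=> hU' UU'; have [U'k _] := (corank_overgroupP _ _).1 hU'.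
  have U'Y : roots_of rs U' `<=` Y by apply: roots_ofS; exact: overgroup_join_ub.
  have [_ sp] := generated_span hY frefl U'Y U'k (fun i => roots_ofS UU' (yU i)) fyi.
  exact: sp.
have ME := reflection_subgroup_simple overgroup_join_reflection.
have spanM b : Y b -> lin_span (f @` J `|` range (f \o y)) (f b).
  move=> Yb; have Y1 : unit_set B Y by move=> a /hY.1/root_norm1.
  have XY : [set a | exists U', [/\ corank_overgroup rs J k U', U `<=` U'
                                  & roots_of rs U' a]] `<=` Y.
    by move=> a [U' [hU' UU']]; apply: roots_ofS; exact: overgroup_join_ub.
  apply: lin_span_sub (refl_group_span Y1 hY.2 frefl XY Yb Yb.2).
  by move=> _ [a [U' [hU' UU' aU']] <-]; exact: span aU'.
(* [k + 1] simple roots of the join outside [J] would have independent lifts in a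
   space of dimension [k] modulo [J]. *)
have Mk : generated_by overgroup_join k.
  have [[s [us sk sY]]|[s [sk sE]]] := uniq_or_enum (subsystem_simple rs Y `\` J) k.+1.
    have si := @coord_lift_indep _ _ _ rs' J s JY us sY.
    have sspan (i : 'I_(size s)) : lin_span (f @` J `|` range (f \o y)) (f s`_i).
      by have [/subsystem_simple_sub/spanM] := sY _ (mem_nth 0 (ltn_ord i)).
    have [+ _] := indep_mod_exchange si sspan.
    by rewrite sk ltnn.
  exists s; split=> // [a sa|].
    by have [/subsystem_simple_sub/hY.1] : (subsystem_simple rs Y `\` J) a by rewrite sE.
  by rewrite ME -sE setDUK.
by apply/corank_overgroupP; split=> // n; exact: rank_min.
Qed.

Lemma overgroup_join_max : max_corank_overgroup rs J k overgroup_join.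
Proof.
split=> [|U' hU' MU']; first exact: overgroup_join_corank.
apply/seteqP; split=> //; apply: overgroup_join_ub => //.
by apply: subset_trans MU'; apply: overgroup_join_ub => //; exact: corank_self.
Qed.

Lemma max_overgroup_join M : max_corank_overgroup rs J k M -> U `<=` M ->
  M = overgroup_join.
Proof.
move=> [Mk Mmax] UM; apply/esym/Mmax; first exact: overgroup_join_corank.
exact: overgroup_join_ub.
Qed.

End Maximum.

End Corank.

(** * Overgroups of parabolic and of closed reflection subgroups *)

Lemma lin_indep_sub (R : realType) (V : lmodType R) (X Y : set V) :
  X `<=` Y -> lin_indep Y -> lin_indep X.
Proof. by move=> XY Yi s c us sX; apply: Yi => // x /sX/XY. Qed.

Section Overgroups.
Context (R : realType) (V : lmodType R) (B : {symmetric V}).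
Context (rs : basedRootSystem B) (J : set V) (JP : J `<=` simple_roots rs).
Implicit Types (a b x : V) (s : seq V) (U : set (V -> V)) (n k : nat).
Notation P := (simple_roots rs).
Notation F := (root_set rs).
Notation C := (conic_span P).

(** When [Pi_U] is linearly independent, [U] has [k] roots independent modulo [J],
    namely elements of [Pi_U] outside [J]. *)
Lemma corank_basis U k : corank_overgroup rs J k U ->
  lin_indep (simple_roots_of rs U) ->
  exists y : 'I_k -> V, (forall i, roots_of rs U (y i)) /\ indep_mod J y.
Proof.
move=> hk Ui; have [[rU _] _] := hk; have [gU _ _] := rU.
have [Uk kmin] := (corank_overgroupP JP _ _).1 hk.
set X := subsystem_simple rs (roots_of rs U).
have JX : J `<=` X.
  apply: simple_sub_subsystem => //; first exact: roots_of_subsystem.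
  by apply: overgroup_roots => //; exact: (generated_overgroup JP Uk).
have XU : X `<=` roots_of rs U by exact: subsystem_simple_sub.
have XF : X `<=` F by move=> a /XU[].
have [s [us sk sX]] := corank_simple kmin (reflection_subgroup_simple rU) JX XF.
subst k; exists (fun i => s`_i); split.
  by move=> i; have [/XU] := sX _ (mem_nth 0 (ltn_ord i)).
apply: lin_indep_indep_mod us sX => //; apply: lin_indep_sub Ui.
exact: subsystem_simple_canonical.
Qed.

Lemma closed_max_corank U k : corank_overgroup rs J k U ->
  lin_indep (simple_roots_of rs U) ->
  roots_of rs U = F `&` lin_span (roots_of rs U) ->
  max_corank_overgroup rs J k U.
Proof.
move=> hk Ui Ucl; have [y [yU yi]] := corank_basis hk Ui.
split=> // U' hU' UU'; apply/seteqP; split=> //.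
have [[rU _] _] := hk; have [[rU' _] _] := hU'.
have [U'k _] := (corank_overgroupP JP _ _).1 hU'.
apply: (reflection_subgroup_le rU') => // b bU'; rewrite Ucl; split; first by case: bU'.
have [_ /(_ (leqnn k) _ bU')] := generated_rank JP rU' (fun i => roots_ofS UU' (yU i)) yi U'k.
apply: lin_span_sub => t [Jt|[i _ <-]]; apply: lin_span_mem => //.
by apply: (overgroup_roots JP (generated_overgroup JP ((corank_overgroupP JP _ _).1 hk).1)).
Qed.

(** Adjoining a root [a] outside the span of [Phi_U] raises the rank modulo [J] by
    one. *)
Lemma adjoin_root U k (y : 'I_k -> V) a : corank_overgroup rs J k U ->
  (forall i, roots_of rs U (y i)) -> indep_mod J y ->
  F a -> ~ lin_span (roots_of rs U) a ->
  let U' := refl_group B (roots_of rs U `|` [set a]) in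
  generated_by rs J U' k.+1 /\
  exists y' : 'I_k.+1 -> V, (forall i, roots_of rs U' (y' i)) /\ indep_mod J y'.
Proof.
move=> hk yU yi Fa na U'.
have [[s [sk sF UE]] _] := (corank_overgroupP JP _ _).1 hk.
have [[rU _] _] := hk; have UE' := reflection_subgroupE rU.
have JU := overgroup_roots JP (generated_overgroup JP ((corank_overgroupP JP _ _).1 hk).1).
have asF : word F (a :: s) by apply/word_cons.
split.
  exists (a :: s); split=> //; apply/seteqP; split.
    apply: refl_group_min => [|b [[_ Ub]|->]].
    - exact/refl_group_transf/(generators_unit JP).
    - move: Ub; rewrite [X in X _]UE; apply: refl_groupS => c [Jc|sc]; [by left|].
      by right; rewrite /= inE [_ \in _]sc orbT.
    - by apply: refl_group_mem; right; rewrite /= inE eqxx.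
  apply: refl_group_min => [|b [Jb|]].
  - by apply: refl_group_transf => b [[/root_norm1//]|->]; exact: root_norm1 Fa.
  - by apply: refl_group_mem; left; exact: JU.
  - rewrite /= inE => /orP[/eqP->|sb]; first by apply: refl_group_mem; right.
    apply: refl_group_mem; left; split; first exact: sF.
    by rewrite UE; apply: refl_group_mem; right.
exists (fun i => if unlift ord0 i is Some j then y j else a); split.
  move=> i; case: unliftP => [j _|_]; split=> //.
  - by case: (yU j).
  - by apply: refl_group_mem; left.
  - by apply: refl_group_mem; right.
move=> c; rewrite big_ord_recl unlift_none; under eq_bigr do rewrite liftK.
move=> h; have h' : lin_span (roots_of rs U) (c ord0 *: a).
  have hU := lin_span_sub (fun b Jb => lin_span_mem (JU b Jb)) h.
  rewrite -[_ *: a](addrK (\sum_(j < k) c (lift ord0 j) *: y j)); apply: lin_spanB => //.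
  by apply: lin_span_sum => j _; apply/lin_spanZ/lin_span_mem.
have c0 : c ord0 = 0.
  apply: contrapT => /eqP c0; apply: na.
  by have := lin_spanZ (c ord0)^-1 h'; rewrite scalerA mulVf// scale1r.
move: h; rewrite c0 scale0r add0r => /yi cy i; case: (unliftP ord0 i) => [j ->|->//]; exact: cy.
Qed.

(** A simple root that is a conic combination of positive roots is one of them. *)
Lemma simple_in_cone X a : X `<=` F `&` C -> P a -> conic_span X a -> X a.
Proof.
move=> XFC Pa aX.
suff h v : conic_span X v -> forall p, 0 < p -> v = p *: a -> X a.
  by apply: (h a aX 1); rewrite ?scale1r.
elim/conic_span_ind=> [|c x w c0 Xx wX IH] p p0.
  move/esym/eqP; rewrite scaler_eq0 gt_eqF//= => /eqP.
  by move/(root_neq0 (simple_root Pa)).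
have [Fx Cx] := XFC _ Xx.
have [->|cn0] := eqVneq c 0; first by rewrite scale0r add0r; exact: IH.
have Cw : C w by apply: conic_span_sub wX => b /XFC[].
move=> /(simple_ray Pa (conic_spanZ c0 Cx) Cw)[q q0 xE].
suff <- : x = a by [].
apply: (root_ray (p := c^-1 * q) (simple_root Pa) Fx); first by rewrite mulr_ge0 ?invr_ge0.
by rewrite -scalerA -xE scalerA mulVf// scale1r.
Qed.

(** A parabolic subgroup is conjugate to a standard one by an element that sends
    its simple roots to positive roots. *)
Lemma parabolic_min U : parabolic rs U -> exists s K,
  [/\ word P s, K `<=` P, forall b, K b -> C (act B s b)
    & forall f, U f <-> refl_group B K (act B (rev s) \o f \o act B s)].
Proof.
move=> [w [w' [K [+ [ww' w'w] KP UE]]]].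
have P1 := @simple_unit _ _ _ rs.
have K1 : unit_set B K by move=> a /KP/P1.
have [_ KM _] := refl_group_transf K1.
rewrite /coxeter_group refl_groupE// => -[s0 s0P s0E].
pose Q m := exists s, [/\ word P s, size s = m
  & forall f, U f <-> refl_group B K (act B (rev s) \o f \o act B s)].
have w'E : w' = act B (rev s0).
  apply/funext => v; apply: (can_inj ww'); rewrite w'w -s0E.
  by rewrite (actKV P1 s0P).
have [|m + m_min] := @ex_minnP (fun m => `[< Q m >]).
  exists (size s0); apply/asboolP; exists s0; split=> // f; rewrite UE -w'E s0E.
  split=> [[u uK <-]|fK].
    by congr (refl_group B K _): uK; apply/funext => v /=; rewrite !ww'.
  exists (w' \o f \o w) => //.
  by apply/funext => v /=; rewrite !w'w.
move=> /asboolP[s [sP sm sU]]; exists s, K; split=> // b Kb; have Pb := KP _ Kb.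
have [//|Cn] := root_sign (root_act_simple sP (simple_root Pb)).
(* A shortest word works: if it made [b] negative, the shorter word for [s s_b]
   would conjugate [W_K] to the same subgroup. *)
have [t [tP ts tE]] := exchange sP Pb Cn.
have : (m <= size t)%N; last by rewrite leqNgt -sm ts.
apply: m_min; apply/asboolP; exists t; split=> // f; rewrite sU tE.
have sbK := sym_reflK (P1 _ Pb).
have tE' : act B (rev t) = sym_refl B b \o act B (rev s).
  apply/funext => v; apply: (can_inj (actK P1 tP)); rewrite (actKV P1 tP) tE.
  by rewrite act_rcons /= sbK (actKV P1 sP).
have bK : refl_group B K (sym_refl B b) by exact: refl_group_mem.
rewrite tE'; split=> fK.
  have := KM _ _ bK (KM _ _ fK bK); congr (refl_group B K _).
  by apply/funext => v /=; rewrite act_rcons.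
have := KM _ _ bK (KM _ _ fK bK); congr (refl_group B K _).
by apply/funext => v /=; rewrite act_rcons !sbK.
Qed.

Section Parabolic.
Variables (U : set (V -> V)) (k : nat) (s : seq V) (K : set V).
Hypotheses (hk : corank_overgroup rs J k U) (sP : word P s) (KP : K `<=` P).
Hypothesis sK : forall b, K b -> C (act B s b).
Hypothesis UE : forall f, U f <-> refl_group B K (act B (rev s) \o f \o act B s).
Notation P1 := (@simple_unit _ _ _ rs).
Notation sKs := (act B s @` K).
Notation e := (@coord_vec R V).

Let sFC : sKs `<=` F `&` C.
Proof.
move=> _ [b Kb <-]; split; last exact: sK.
by apply: root_act_simple => //; apply: simple_root; exact: KP.
Qed.

Lemma parabolic_conj b : U (sym_refl B b) <->
  refl_group B K (sym_refl B (act B (rev s) b)).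
Proof.
rewrite UE; suff -> : act B (rev s) \o sym_refl B b \o act B s =
  sym_refl B (act B (rev s) b) by [].
apply/funext => v /=; rewrite -(sym_refl_actJ P1); last exact: word_rev.
by rewrite (actK P1 sP).
Qed.

(** [U] is generated by the reflections along [s K]. *)
Lemma parabolic_generators : U = refl_group B sKs.
Proof.
have gU : transf_group U by case: hk => -[[]].
have [[rU _] _] := hk.
apply/seteqP; split; last first.
  apply: refl_group_min => // _ [b Kb <-]; apply/parabolic_conj.
  by rewrite (actK P1 sP); exact: refl_group_mem.
move=> f /UE; rewrite refl_groupE; last by move=> a /KP/P1.
move=> [t tK tE]; suff -> : f = act B (map (act B s) t).
  by apply: refl_group_act => _ /mapP[b /tK Kb ->]; exists b.
apply/funext => v; rewrite -[v in RHS](actKV P1 sP) -(act_map P1 _ _ sP) tE /=.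
by rewrite !(actKV P1 sP).
Qed.

(** For [a] in [J] the root [s^-1 a] is in [Phi_K], so [a] is a conic combination of
    [s K] or the opposite of one; as [s K] is positive and [a] is simple, [a] is in
    [s K]. *)
Lemma parabolic_sub_generators : J `<=` sKs.
Proof.
move=> a Ja; have Pa := JP Ja; have Fa := simple_root Pa.
have [[_ JU] _] := hk.
have rsP := word_rev sP.
have Fga := root_act_simple rsP Fa.
have gaK : refl_group B K (sym_refl B (act B (rev s) a)).
  by apply/parabolic_conj; apply: JU; exact: refl_group_mem.
have cone b : conic_span K b -> conic_span sKs (act B s b).
  elim/conic_span_ind=> [|c x w c0 Kx _ IH]; first by rewrite act0; exact: conic_span0.
  rewrite actP; apply: conic_spanD IH; apply: conic_spanZ => //.
  by apply: conic_span_mem; exists x.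
have [Ca|Ca] := root_sign Fga.
  apply: simple_in_cone Pa _ => //; rewrite -[a](actKV P1 sP); apply: cone.
  by apply: (parabolic_cone Fga Ca); exact: parabolic_lift.
have : conic_span K (- act B (rev s) a).
  apply: (parabolic_cone (root_opp Fga) Ca); apply: parabolic_lift => //.
    exact: root_opp.
  by rewrite sym_refl_opp.
move=> /cone; rewrite actN (actKV P1 sP) => naK.
case: (root_npos Fa (conic_span_mem Pa)).
by apply: conic_span_sub naK => b /sFC[].
Qed.

Lemma parabolic_max : max_corank_overgroup rs J k U.
Proof.
split=> // U' hU' UU'; apply/seteqP; split=> //.
have [Uk kmin] := (corank_overgroupP JP _ _).1 hk.
have [U'k _] := (corank_overgroupP JP _ _).1 hU'.
have [[rU _] _] := hk; have [[rU' _] _] := hU'.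
have JK := parabolic_sub_generators.
have [|t [ut tk tK]] := corank_simple kmin parabolic_generators JK.
  by move=> b /sFC[].
pose y (i : 'I_(size t)) := t`_i.
pose f := coord_lift rs.
have yK i : (sKs `\` J) (y i) by apply: tK; rewrite mem_nth.
have yU i : roots_of rs U' (y i).
  apply: (roots_ofS UU'); have [/[dup] yiK /sFC[? _] _] := yK i; split=> //.
  by rewrite parabolic_generators; exact: refl_group_mem.
have fst_e a : P a -> fst (e a) = a by [].
have fact b : K b -> f (act B s b) = lift_act B fst e s (e b).
  by move=> /KP Pb; exact: (liftE fst_e sP Pb).
(* The dual family reads the coordinates after [s^-1], which sends the lift of
   [s K] to independent vectors. *)
have yi : indep_mod (f @` J) (f \o y).
  pose phi (i : 'I_(size t)) (x : V * (V -> R^o)) :=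
    (lift_act B fst e (rev s) x).2 (act B (rev s) (y i)).
  apply: (@indep_mod_dual R (V * (V -> R^o))%type _ _ _ phi).
  - by move=> i c u v; rewrite /phi lift_actP coordP.
  - move=> i _ [a Ja <-]; rewrite /phi; have [b Kb bE] := JK _ Ja.
    rewrite -bE fact// (lift_actK fst_e sP) coord_vecE; case: eqP => // ib.
    have [_ []] := yK i; rewrite -[y i](actKV P1 sP) ib bE; exact: Ja.
  - move=> i j; rewrite /phi /=; have [[b Kb bE] _] := yK j.
    rewrite -bE fact// (lift_actK fst_e sP) coord_vecE.
    rewrite -[b in LHS](actK P1 sP) bE (can_eq (actKV P1 sP)).
    by rewrite /y nth_uniq.
have FU' : roots_of rs U' `<=` F by move=> b [].
have hF : subsystem rs F by split=> // a b; exact: root_refl.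
have [_ sp] := generated_span JP hF (@coord_lift_refl _ _ _ rs) FU' U'k yU yi.
apply: (reflection_subgroup_le rU') => // b bU'; have [Fb _] := bU'; split=> //.
have spK : lin_span (f @` sKs) (f b).
  apply: lin_span_sub (sp (eq_leq (esym tk)) _ bU') => _ [[a Ja <-]|[i _ <-]]; apply: lin_span_mem.
    by exists a => //; exact: JK.
  by exists (y i) => //; have [] := yK i.
apply/parabolic_conj; apply: (parabolic_root KP (root_act_simple (word_rev sP) Fb)).
rewrite /coord_lift (lift_act_root fst_e (word_rev sP) Fb).
elim/lin_span_ind: {b Fb bU'}(lift_root rs fst e b) / spK => [|c _ x [_ [b Kb <-] <-] _ IH].
  by rewrite lift_act0; exact: lin_span0.
rewrite lift_actP; apply: lin_spanD IH; apply: lin_spanZ.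
by rewrite fact// (lift_actK fst_e sP); apply: lin_span_mem; exists b.
Qed.

End Parabolic.

End Overgroups.

Theorem theorem1p30 (R : realType) (V : lmodType R) (B : {symmetric V})
    (rs : basedRootSystem B) (J : set V) (U : set (V -> V)) (k : nat)
    (hJ : J `<=` simple_roots rs)
    (hU : reflection_overgroup rs J U)
    (hk : has_corank rs U (refl_group B J) k) :
  [/\ (* (a) *)
      parabolic rs U -> max_corank_overgroup rs J k U,
      (* (b) *)
      lin_indep (simple_roots_of rs U) ->
        (exists M, [/\ corank_overgroup rs J k M, U `<=` M
           & forall U', corank_overgroup rs J k U' -> U `<=` U' -> U' `<=` M])
        /\ (exists! M, max_corank_overgroup rs J k M /\ U `<=` M)
    & (* (c) *)
      lin_indep (simple_roots_of rs U) ->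
      roots_of rs U = root_set rs `&` lin_span (roots_of rs U) ->
        max_corank_overgroup rs J k U /\
        (let I := [set W' | max_corank_overgroup rs J k.+1 W' /\ U `<=` W'] in
         root_set rs `\` roots_of rs U
           = \bigcup_(W' in I) (roots_of rs W' `\` roots_of rs U) /\
         trivIset I (fun W' => roots_of rs W' `\` roots_of rs U))].
Proof.
have UJk : corank_overgroup rs J k U by [].
have [Uk kmin] := (corank_overgroupP hJ _ _).1 UJk.
split.
- move=> /parabolic_min[s [K [sP KP sK UE]]].
  exact: parabolic_max UE.
- move=> /(corank_basis hJ UJk)[y [yU yi]].
  have UM := overgroup_join_ub UJk (@subset_refl _ U).
  split; exists (overgroup_join rs J U k).
    split=> //; first exact: overgroup_join_corank yi.
    by move=> U'; exact: overgroup_join_ub.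
  split; first by split=> //; exact: overgroup_join_max yi.
  by move=> M [hM UM']; apply/esym/(max_overgroup_join _ Uk yU yi).
move=> Ui Ucl; split; first exact: closed_max_corank.
have [y [yU yi]] := corank_basis hJ UJk Ui.
set I := [set W' | _] => /=.
have UaI a : root_set rs a -> ~ roots_of rs U a ->
    exists M, [/\ I M, roots_of rs M a & forall W, I W -> roots_of rs W a -> W = M].
  move=> Fa na; have nsa : ~ lin_span (roots_of rs U) a.
    by move=> sa; apply: na; rewrite Ucl.
  have [Uak [y' [yU' yi']]] := adjoin_root hJ UJk yU yi Fa nsa.
  set Ua := refl_group B _ in Uak yU'.
  have UUa : U `<=` Ua.
    rewrite [X in X `<=` _](reflection_subgroupE hU.1).
    by apply: refl_groupS => b; left.
  have Uaa : roots_of rs Ua a by split=> //; apply: refl_group_mem; right.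
  have UaM := overgroup_join_ub (corank_self hJ Uak yU' yi') (@subset_refl _ Ua).
  exists (overgroup_join rs J Ua k.+1); split.
  - by split; [exact: overgroup_join_max yi'|exact: subset_trans UaM].
  - exact: roots_ofS Uaa.
  move=> W [hW UW] Wa; apply: (max_overgroup_join hJ Uak yU' yi') => //.
  have [[[rW _] _] _] := hW.
  rewrite [X in _ `<=` X](reflection_subgroupE rW); apply: refl_groupS => b [|->//].
  exact: roots_ofS.
split.
  apply/seteqP; split=> [a [Fa na]|a [W _ [[Fa _] na]]//].
  by have [M [IM Ma _]] := UaI a Fa na; exists M.
move=> W1 W2 IW1 IW2 [a [[[Fa W1a] na] [[_ W2a] _]]].
by have [M [_ _ MU]] := UaI a Fa na; rewrite (MU W1)// (MU W2).
Qed.
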